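(* For every $d\in\mathbb{N}$, we have \[ \overline{\operatorname{asdim}}_{\mathrm{poly}(d)}\mathbb{H}^2 = 2. \]
   Context: $\mathbb{H}^2$ is the hyperbolic plane (replaced by a maximal $1$-separated subset). $\overline{\operatorname{asdim}}_{\mathrm{poly}(d)}(X)$ is the least $n$ such that for every $r\geq0$, $X=X_0\cup\dots\cup X_n$ with each $X_i$ a disjoint union of pieces pairwise at distance at least $r$, such that, writing $\mathcal Y$ for the family of all pieces, for all $m,s\geq 1$ the family $N^m_s(\mathcal Y)=\{N^m_s(Y)\}$ has uniform growth at most $C\rho^d+C$ (for some $C$ depending on $m,s$). Here $N^0_s(Y)=Y$ and $N^{k+1}_s(Y)$ is the union of all $Y'\in\mathcal Y$ intersecting the closed $s$-neighbourhood of $N^k_s(Y)$. *)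

(* Defs.v *)
From Stdlib Require Import Reals List.
Open Scope R_scope.

Definition pt : Type := (R * R)%type.

Definition inH2 (p : pt) : Prop := 0 < snd p.

(* hyperbolic distance:
   d(p,q) = arcosh (1 + |p-q|^2 / (2 y_p y_q)),  arcosh t = ln (t + sqrt (t^2-1)) *)
Definition hdist (p q : pt) : R :=
  let t := 1 + ((fst p - fst q) ^ 2 + (snd p - snd q) ^ 2) / (2 * snd p * snd q) in
  ln (t + sqrt (t ^ 2 - 1)).

Definition max_1_separated (X : pt -> Prop) : Prop :=
  (forall p, X p -> inH2 p) /\
  (forall p q, X p -> X q -> p <> q -> 1 <= hdist p q) /\
  (forall p, inH2 p -> ~ X p -> exists q, X q /\ hdist p q < 1).

Definition nbhd {T : Type} (dist : T -> T -> R) (A : T -> Prop) (s : R) (x : T) : Prop :=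
  exists y, A y /\ dist x y <= s.

Fixpoint iter_nbhd {T I : Type} (dist : T -> T -> R) (valid : I -> Prop)
  (Pc : I -> T -> Prop) (s : R) (k : nat) (Y : T -> Prop) : T -> Prop :=
  match k with
  | O => Y
  | S k' => fun x => exists i, valid i /\ Pc i x /\
              exists z, Pc i z /\ nbhd dist (iter_nbhd dist valid Pc s k' Y) s z
  end.

Definition growth_at_most {T : Type} (dist : T -> T -> R) (Z : T -> Prop)
  (f : R -> R) : Prop :=
  forall (z : T) (rho : R), Z z -> 0 <= rho ->
  forall l : list T, NoDup l -> (forall w, In w l -> Z w /\ dist z w <= rho) ->
  INR (length l) <= f rho.

Definition poly_asdim_prop {T : Type} (dist : T -> T -> R) (X : T -> Prop)
  (d n : nat) : Prop :=
  forall r : R, 0 <= r ->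
  exists (J : Type) (Pc : nat -> J -> T -> Prop),
    (forall x, X x <-> exists i j, (i <= n)%nat /\ Pc i j x) /\
    (forall i j j', (i <= n)%nat -> j <> j' ->
       forall x y, Pc i j x -> Pc i j' y -> x <> y /\ r <= dist x y) /\
    (forall (m : nat) (s : R), (1 <= m)%nat -> 1 <= s ->
       exists C : R, forall i j, (i <= n)%nat ->
         growth_at_most dist
           (iter_nbhd dist (fun p : nat * J => (fst p <= n)%nat)
                      (fun p : nat * J => Pc (fst p) (snd p)) s m (Pc i j))
           (fun rho => C * rho ^ d + C)).

Definition poly_asdim_eq {T : Type} (dist : T -> T -> R) (X : T -> Prop)
  (d n : nat) : Prop :=
  poly_asdim_prop dist X d n /\
  (forall k, (k < n)%nat -> ~ poly_asdim_prop dist X d k).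

(* Main.v *)
Require Import Defs.
From Stdlib Require Import Reals List.
From Stdlib Require Import Arith Bool ZArith Lia Lra Psatz ClassicalEpsilon.

(* Upper bound: a brick-like tiling of the half-plane has three colours of uniformly
   bounded pieces, so all iterated neighbourhoods are bounded, hence finite of
   bounded cardinality.

   Lower bound: let the net be coloured with two colours and label the points by
   their pieces.  Approximate the half-plane by the 16-ary tree of dyadic-like
   squares with horizontal edges added.  Adjacent squares of the same colour carry
   the same label, so two of the three labels of any triangle coincide.  Suppose that
   the pieces within m steps of the piece at a square v do not reach depth T below v.
   A parity count of the edges leaving this union of pieces then shows that one
   single piece meets all vertical columns below v, at depth more than m; for large m
   this contradicts polynomial growth, since the number of its squares at depth n is
   too small for Kraft's inequality.  Thus m steps always suffice to reach every depth
   below every square.  At least n/2 of any n squares can be given pairwise disjoint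
   subtrees (their own or that of a child), so repeating the argument in these
   subtrees, e times (m + 1) steps reach at least of the order of rho^e points within
   distance rho.  For e = d + 1 this contradicts growth of degree d. *)

Open Scope nat_scope.

(** * Two-coloured labellings of the 16-ary plane tree *)

(** A mod 2 cochain on edges: [f] will mark the labels outside the union of pieces reached so far,
    and an edge counts when it leads from that union into the single outside label [B]. It does not
    depend on the orientation of the edge. *)
Definition crossing {L : Type} (f : L -> bool) (B p q : L) : bool :=
  if excluded_middle_informative (p = B) then
    if excluded_middle_informative (q = B) then false else f p && negb (f q)
  else
    if excluded_middle_informative (q = B) then f q && negb (f p) else false.

Lemma crossing_refl {L : Type} (f : L -> bool) (B p : L) : crossing f B p p = false.
Proof. unfold crossing; destruct (excluded_middle_informative (p = B)); reflexivity. Qed.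

Lemma crossing_sym {L : Type} (f : L -> bool) (B p q : L) : crossing f B p q = crossing f B q p.
Proof.
  unfold crossing; destruct (excluded_middle_informative (p = B));
    destruct (excluded_middle_informative (q = B)); reflexivity.
Qed.

(* With only two colours, two of the three labels of a triangle are equal. *)
Lemma crossing_triangle {L : Type} (f : L -> bool) (col : L -> bool) (B p q r : L) :
  (col p = col q -> p = q) -> (col q = col r -> q = r) -> (col p = col r -> p = r) ->
  xorb (crossing f B p q) (crossing f B q r) = crossing f B p r.
Proof.
  intros H1 H2 H3.
  assert (p = q \/ q = r \/ p = r) as [-> | [-> | ->]].
  { destruct (col p), (col q), (col r); intuition congruence. }
  - rewrite crossing_refl; apply xorb_false_l.
  - rewrite crossing_refl; apply xorb_false_r.
  - rewrite crossing_refl, (crossing_sym f B q r); apply xorb_nilpotent.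
Qed.

Definition compatible {L : Type} (col : L -> bool) (p q : L) : Prop := col p = col q -> p = q.

(* Labellings of the vertices [(n, a)] of the plane tree where [(n, a)] has the
   children [(S n, 16 * a + j)], [j < 16]. *)
Definition two_coloured {L : Type} (col : L -> bool) (lab : nat -> nat -> L) : Prop :=
  (forall n a, compatible col (lab n a) (lab n (S a))) /\
  (forall n a j, j < 16 -> compatible col (lab n a) (lab (S n) (16 * a + j))) /\
  (forall n a, compatible col (lab n (S a)) (lab (S n) (16 * a + 15))).

Fixpoint crossing_parity {L : Type} (f : L -> bool) (B : L) (p : nat -> L) (n : nat) : bool :=
  match n with
  | O => false
  | S n' => xorb (crossing_parity f B p n') (crossing f B (p n') (p (S n')))
  end.

Lemma crossing_parity_absent {L : Type} (f : L -> bool) (B : L) (p : nat -> L) n :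
  (forall k, k <= n -> p k <> B) -> crossing_parity f B p n = false.
Proof.
  induction n as [|n IH]; intros H; [reflexivity|].
  simpl; rewrite IH by (intros; apply H; lia).
  unfold crossing; destruct (excluded_middle_informative (p n = B)) as [E|_];
    [destruct (H n ltac:(lia) E)|].
  destruct (excluded_middle_informative (p (S n) = B)) as [E|_]; [destruct (H (S n) ltac:(lia) E)|].
  reflexivity.
Qed.

Definition indicator {L : Type} (B x : L) : bool :=
  if excluded_middle_informative (x = B) then true else false.

(** The classes of equal entries partition the list, so they cannot all have even size. The
    induction discards the class of the head when it is even. *)
Lemma exists_odd_label {L : Type} (l : list L) :
  Nat.odd (length l) = true ->
  exists B, In B l /\ Nat.odd (length (filter (indicator B) l)) = true.
Proof.
  remember (length l) as n eqn:En; revert l En.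
  induction n as [n IH] using lt_wf_ind; intros [|x l] En Hodd; [subst n; discriminate|].
  destruct (Nat.odd (length (filter (indicator x) (x :: l)))) eqn:Ex.
  { exists x; split; [left; reflexivity | exact Ex]. }
  pose proof (filter_length (indicator x) (x :: l)) as Hl.
  set (l' := filter (fun y => negb (indicator x y)) (x :: l)) in *.
  assert (Hx : 0 < length (filter (indicator x) (x :: l))).
  { simpl; unfold indicator at 1; destruct (excluded_middle_informative (x = x)); [simpl; lia | congruence]. }
  destruct (IH (length l') ltac:(lia) l' eq_refl) as (B & HB & Hc).
  { subst n; rewrite <- Hl, Nat.odd_add, Ex in Hodd; destruct (Nat.odd (length l')); [reflexivity | discriminate]. }
  apply filter_In in HB; destruct HB as [HB HBx].
  exists B; split; [exact HB|].
  (* Since [B] differs from [x], removing the copies of [x] does not change the occurrences of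
     [B]. *)
  rewrite <- Hc; f_equal; f_equal; unfold l'.
  clear -HBx; induction (x :: l) as [|y m IHm]; [reflexivity|].
  simpl; unfold indicator in *.
  destruct (excluded_middle_informative (y = B)) as [->|Hy].
  - rewrite HBx; simpl; destruct (excluded_middle_informative (B = B)); [f_equal; exact IHm | congruence].
  - rewrite IHm; destruct (excluded_middle_informative (y = x)); simpl; [reflexivity|].
    destruct (excluded_middle_informative (y = B)); [congruence | reflexivity].
Qed.

(** One entry for each step of the path at which [f] changes, namely the label at the end where [f]
    is true. Its length has the parity of all changes of [f], and the multiplicity of [B] in it has
    the parity of the crossings into [B]. *)
Fixpoint crossing_labels {L : Type} (f : L -> bool) (p : nat -> L) (n : nat) : list L :=
  match n with
  | O => nil
  | S n' =>
    (if f (p n') then if f (p (S n')) then nil else p n' :: nil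
     else if f (p (S n')) then p (S n') :: nil else nil) ++ crossing_labels f p n'
  end.

Lemma crossing_labels_odd {L : Type} (f : L -> bool) (p : nat -> L) n :
  Nat.odd (length (crossing_labels f p n)) = xorb (f (p 0)) (f (p n)).
Proof.
  induction n as [|n IH]; [simpl; destruct (f (p 0)); reflexivity|].
  cbn [crossing_labels]; rewrite length_app, Nat.odd_add, IH.
  destruct (f (p 0)), (f (p n)), (f (p (S n))); reflexivity.
Qed.

Lemma crossing_labels_true {L : Type} (f : L -> bool) (p : nat -> L) n B :
  In B (crossing_labels f p n) -> f B = true.
Proof.
  induction n as [|n IH]; [intros []|].
  cbn [crossing_labels]; rewrite in_app_iff; intros [H|H]; [|exact (IH H)].
  destruct (f (p n)) eqn:E1, (f (p (S n))) eqn:E2; simpl in H; intuition congruence.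
Qed.

Lemma crossing_labels_parity {L : Type} (f : L -> bool) (p : nat -> L) n B : f B = true ->
  Nat.odd (length (filter (indicator B) (crossing_labels f p n))) = crossing_parity f B p n.
Proof.
  intros HB; induction n as [|n IH]; [reflexivity|].
  cbn [crossing_labels crossing_parity]; rewrite filter_app, length_app, Nat.odd_add, IH, xorb_comm.
  f_equal; unfold crossing.
  destruct (f (p n)) eqn:E1, (f (p (S n))) eqn:E2; simpl; unfold indicator;
    destruct (excluded_middle_informative (p n = B)) as [E3|E3];
    destruct (excluded_middle_informative (p (S n) = B)) as [E4|E4]; simpl; (reflexivity || congruence).
Qed.

(** The labels along the branch from the root to the vertex [(T, a)]: dividing by [16 ^ (T - n)]
    gives the ancestor at level [n]. *)
Definition column {L : Type} (lab : nat -> nat -> L) (T a : nat) (n : nat) : L :=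
  lab n (a / 16 ^ (T - n)).

Lemma column_div T a n : n < T -> a / 16 ^ (T - n) = (a / 16 ^ (T - S n)) / 16.
Proof.
  intros H; replace (T - n) with (S (T - S n)) by lia.
  rewrite Nat.pow_succ_r', Nat.mul_comm, Nat.Div0.div_div; reflexivity.
Qed.

Lemma div_succ_cases a m : m <> 0 -> S a / m = a / m \/ S a / m = S (a / m).
Proof.
  intros Hm; pose proof (Nat.div_mod_eq a m); pose proof (Nat.mod_upper_bound a m Hm).
  destruct (Nat.eq_dec (S (a mod m)) m).
  - right; symmetry; apply Nat.div_unique with 0; nia.
  - left; symmetry; apply Nat.div_unique with (S (a mod m)); nia.
Qed.

(** The strip between two consecutive columns is triangulated, and [crossing] sums to zero around
    each triangle. Hence the two columns differ, down to level [n], only by the horizontal rung at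
    that level; they start at the same root. *)
Lemma crossing_parity_next {L : Type} (f col : L -> bool) (lab : nat -> nat -> L) (B : L) T a n :
  two_coloured col lab -> S a < 16 ^ T -> n <= T ->
  xorb (crossing_parity f B (column lab T a) n) (crossing_parity f B (column lab T (S a)) n)
  = crossing f B (column lab T a n) (column lab T (S a) n).
Proof.
  intros (Hh & Hv & Hd) Ha; induction n as [|n IH]; intros Hn.
  - unfold column; rewrite Nat.sub_0_r, !Nat.div_small by lia.
    rewrite crossing_refl; reflexivity.
  - specialize (IH ltac:(lia)).
    cbn [crossing_parity].
    assert (X : forall b1 b2 c1 c2, xorb (xorb b1 c1) (xorb b2 c2) = xorb (xorb b1 b2) (xorb c1 c2))
      by (intros [] [] [] []; reflexivity).
    rewrite X, IH; clear X IH.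
    unfold column; rewrite (column_div T a n), (column_div T (S a) n) by lia.
    assert (Hm : 16 ^ (T - S n) <> 0) by (apply Nat.pow_nonzero; lia).
    set (w := a / 16 ^ (T - S n)).
    assert (Hw : w = 16 * (w / 16) + w mod 16) by (apply Nat.div_mod_eq).
    assert (Hj : w mod 16 < 16) by (apply Nat.mod_upper_bound; lia).
    (* If the columns still agree at level [S n], they also agree above it and everything
       cancels. *)
    destruct (div_succ_cases a (16 ^ (T - S n)) Hm) as [E|E]; rewrite E; fold w.
    { rewrite !crossing_refl, xorb_nilpotent; reflexivity. }
    assert (Hvw : compatible col (lab n (w / 16)) (lab (S n) w)) by (rewrite Hw at 2; apply Hv, Hj).
    pose proof (Hh (S n) w) as Hhw.
    (* If [w] and [S w] have the same parent, one triangle fills the strip between the two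
       levels. *)
    destruct (div_succ_cases w 16 ltac:(lia)) as [E'|E']; rewrite E'.
    + assert (Hvw' : compatible col (lab n (w / 16)) (lab (S n) (S w))).
      { pose proof (Nat.div_mod_eq (S w) 16) as D; rewrite E' in D; rewrite D.
        apply Hv, Nat.mod_upper_bound; lia. }
      rewrite crossing_refl, xorb_false_l, (crossing_sym f B (lab n (w / 16))).
      apply crossing_triangle with col; try assumption.
      unfold compatible in *; intros; symmetry; auto.
    (* Otherwise [w] is the last child of its parent and [S w] the first child of the next one, and
       the diagonal edge cuts the quadrilateral into two triangles. *)
    + assert (Hmod : w = 16 * (w / 16) + 15 /\ S w = 16 * S (w / 16) + 0).
      { pose proof (Nat.div_mod_eq (S w) 16) as D; rewrite E' in D.
        pose proof (Nat.mod_upper_bound (S w) 16); lia. }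
      destruct Hmod as [M1 M2].
      assert (Hvw' : compatible col (lab n (S (w / 16))) (lab (S n) (S w)))
        by (rewrite M2; apply Hv; lia).
      assert (Hdw : compatible col (lab n (S (w / 16))) (lab (S n) w))
        by (rewrite M1 at 2; apply Hd).
      pose proof (Hh n (w / 16)) as Hhq.
      set (p := lab n (w / 16)) in *; set (p' := lab n (S (w / 16))) in *.
      set (q := lab (S n) w) in *; set (q' := lab (S n) (S w)) in *.
      pose proof (crossing_triangle f col B p p' q Hhq Hdw Hvw) as T1.
      assert (T2 : xorb (crossing f B q p') (crossing f B p' q') = crossing f B q q').
      { apply crossing_triangle with col; try assumption.
        unfold compatible in *; intros; symmetry; auto. }
      rewrite (crossing_sym f B q p') in T2; rewrite <- T1, <- T2.
      destruct (crossing f B p p'), (crossing f B p' q), (crossing f B p' q'); reflexivity.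
Qed.

(* The parity with which [B] is entered is the same on all columns, and on the
   first column it is odd for some [B]. *)
Lemma exists_blocking_label {L : Type} (f col : L -> bool) (lab : nat -> nat -> L) T :
  two_coloured col lab -> f (lab 0 0) = false ->
  (forall a, a < 16 ^ T -> f (lab T a) = true) ->
  exists B, f B = true /\
    forall a, a < 16 ^ T -> exists n, n <= T /\ lab n (a / 16 ^ (T - n)) = B.
Proof.
  intros Hc H0 HT.
  assert (Hpow : 0 < 16 ^ T) by (apply Nat.neq_0_lt_0, Nat.pow_nonzero; lia).
  destruct (exists_odd_label (crossing_labels f (column lab T 0) T)) as (B & HB & Hodd).
  { rewrite crossing_labels_odd; unfold column.
    rewrite !Nat.Div0.div_0_l, H0, HT by lia; reflexivity. }
  apply crossing_labels_true in HB; rewrite crossing_labels_parity in Hodd by exact HB.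
  exists B; split; [exact HB|].
  assert (Hall : forall a, a < 16 ^ T -> crossing_parity f B (column lab T a) T = true).
  { induction a as [|a IH]; intros Ha; [exact Hodd|].
    pose proof (crossing_parity_next f col lab B T a T Hc Ha (le_n T)) as E.
    rewrite IH in E by lia.
    assert (Hf : forall a, a < 16 ^ T -> f (column lab T a T) = true).
    { intros b Hb; unfold column; rewrite Nat.sub_diag, Nat.div_1_r; auto. }
    (* At the bottom level [f] is true everywhere, so the last rung is not a crossing and the parity
       passes to the next column. *)
    assert (Hz : crossing f B (column lab T a T) (column lab T (S a) T) = false).
    { unfold crossing; rewrite !Hf by lia.
      destruct (excluded_middle_informative _), (excluded_middle_informative _); reflexivity. }
    rewrite Hz in E; destruct (crossing_parity f B (column lab T (S a)) T); [reflexivity | discriminate]. }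
  intros a Ha; destruct (excluded_middle_informative (exists n, n <= T /\ lab n (a / 16 ^ (T - n)) = B))
    as [H|H]; [exact H|].
  specialize (Hall a Ha); rewrite crossing_parity_absent in Hall; [discriminate|].
  intros k Hk E; apply H; exists k; split; [exact Hk | exact E].
Qed.

(** * Subtrees *)

Definition desc (v : nat * nat) (t : nat) (w : nat * nat) : Prop :=
  fst w = fst v + t /\ snd w / 16 ^ t = snd v.

Definition child (v : nat * nat) (j : nat) : nat * nat := (S (fst v), 16 * snd v + j).

Lemma desc_refl v : desc v 0 v.
Proof. split; [lia | apply Nat.div_1_r]. Qed.

Lemma desc0 v w : desc v 0 w -> w = v.
Proof.
  destruct v, w; unfold desc; cbn [fst snd]; intros [E1 E2].
  rewrite Nat.div_1_r in E2; f_equal; lia.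
Qed.

Lemma desc_child v j t w : j < 16 -> desc (child v j) t w -> desc v (S t) w.
Proof.
  intros Hj [H1 H2]; unfold desc, child in *; cbn [fst snd] in *; split; [lia|].
  rewrite Nat.pow_succ_r', Nat.mul_comm, <- Nat.Div0.div_div, H2.
  symmetry; apply Nat.div_unique with j; lia.
Qed.

Lemma desc_succ v t w : desc v (S t) w -> exists j, j < 16 /\ desc (child v j) t w.
Proof.
  intros [H1 H2].
  exists ((snd w / 16 ^ t) mod 16); split; [apply Nat.mod_upper_bound; lia|].
  unfold desc, child; cbn [fst snd]; split; [lia|].
  rewrite Nat.pow_succ_r', Nat.mul_comm, <- Nat.Div0.div_div in H2.
  rewrite <- H2; apply Nat.div_mod_eq.
Qed.

Lemma desc_child_inj v j j' t t' w :
  desc (child v j) t w -> desc (child v j') t' w -> j = j'.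
Proof.
  unfold desc, child; cbn [fst snd]; intros [H1 H2] [H3 H4].
  assert (t = t') by lia; subst t'; lia.
Qed.

(** A form of Kraft's inequality: at least [8 ^ T] columns avoid all marks. The survivors have at
    least [16 * 8 ^ T] children, of which at most [8 ^ S T] are marked, and the difference is again
    [8 ^ S T]. The root is treated separately because the bound [8 ^ 0] would allow it to be
    marked. *)
Lemma sparse_marks_miss_column (mark : nat -> nat -> Prop) T :
  ~ mark 0 0 ->
  (forall n l, NoDup l -> (forall a, In a l -> mark n a) -> length l <= 8 ^ n) ->
  exists a, a < 16 ^ T /\ forall n, n <= T -> ~ mark n (a / 16 ^ (T - n)).
Proof.
  intros H0 Hcount.
  assert (HU : exists U, NoDup U /\ 8 ^ T <= length U /\
    forall a, In a U -> a < 16 ^ T /\ forall n, n <= T -> ~ mark n (a / 16 ^ (T - n))).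
  { induction T as [|T (U & HU & Hlen & Hin)].
    - exists (0 :: nil); split; [repeat constructor; intros []|]; split; [simpl; lia|].
      intros a [<-|[]]; split; [simpl; lia|].
      intros n Hn; replace n with 0 by lia; exact H0.
    - set (mk := fun a => if excluded_middle_informative (mark (S T) a) then true else false).
      set (K := flat_map (fun a => map (fun j => 16 * a + j) (seq 0 16)) U).
      assert (HK : NoDup K /\ length K = 16 * length U).
      { unfold K; clear -HU; induction HU as [|a U Ha HU [IH1 IH2]]; [split; [constructor | reflexivity]|].
        cbn [flat_map]; split; [|rewrite length_app, length_map, length_seq, IH2; simpl length; lia].
        apply NoDup_app; [|exact IH1|].
        - apply NoDup_map_NoDup_ForallPairs; [|apply seq_NoDup].
          intros x y _ _ E; lia.
        - intros x Hx Hx'; apply in_map_iff in Hx; destruct Hx as (j & <- & Hj).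
          apply in_seq in Hj; apply in_flat_map in Hx'; destruct Hx' as (b & Hb & Hx').
          apply in_map_iff in Hx'; destruct Hx' as (i & E & Hi); apply in_seq in Hi.
          assert (a = b) by lia; subst b; contradiction. }
      destruct HK as [HK HKlen].
      exists (filter (fun a => negb (mk a)) K); split; [apply NoDup_filter, HK|]; split.
      + pose proof (filter_length mk K) as Hsum.
        assert (Hm : length (filter mk K) <= 8 ^ S T).
        { apply Hcount; [apply NoDup_filter, HK|].
          intros a Ha; apply filter_In in Ha; destruct Ha as [_ Ha]; unfold mk in Ha.
          destruct (excluded_middle_informative (mark (S T) a)); [assumption | discriminate]. }
        rewrite Nat.pow_succ_r' in *; lia.
      + intros a Ha; apply filter_In in Ha; destruct Ha as [Ha Hma].
        unfold K in Ha; apply in_flat_map in Ha; destruct Ha as (b & Hb & Ha).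
        apply in_map_iff in Ha; destruct Ha as (j & E & Hj); apply in_seq in Hj.
        destruct (Hin b Hb) as [Hb1 Hb2].
        assert (Hdiv : a / 16 = b) by (symmetry; apply Nat.div_unique with j; lia).
        split; [rewrite Nat.pow_succ_r'; lia|].
        intros n Hn; destruct (Nat.eq_dec n (S T)) as [->|Hne].
        * rewrite Nat.sub_diag, Nat.div_1_r; unfold mk in Hma.
          destruct (excluded_middle_informative (mark (S T) a)); [discriminate | assumption].
        * replace (S T - n) with (S (T - n)) by lia.
          rewrite Nat.pow_succ_r'.
          rewrite <- Nat.Div0.div_div, Hdiv; apply Hb2; lia. }
  destruct HU as (U & _ & Hlen & Hin).
  destruct U as [|a U].
  - pose proof (Nat.pow_nonzero 8 T); simpl in Hlen; lia.
  - exists a; apply Hin; left; reflexivity.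
Qed.

(** * Counting vertices and collecting disjoint lists in subtrees *)

Fixpoint count (P : nat * nat -> bool) (v : nat * nat) (n : nat) : nat :=
  Nat.b2n (P v) +
  match n with
  | O => 0
  | S n' => list_sum (map (fun j => count P (child v j) n') (seq 0 16))
  end.

Lemma countS P v n :
  count P v (S n) = Nat.b2n (P v) + list_sum (map (fun j => count P (child v j) n) (seq 0 16)).
Proof. reflexivity. Qed.

Lemma list_sum_le {A : Type} (f g : A -> nat) (l : list A) :
  (forall x, f x <= g x) -> list_sum (map f l) <= list_sum (map g l).
Proof. intros H; induction l as [|x l IH]; simpl; [lia | specialize (H x); lia]. Qed.

Lemma list_sum_lt {A : Type} (f g : A -> nat) (l : list A) x :
  (forall x, f x <= g x) -> In x l -> f x < g x -> list_sum (map f l) < list_sum (map g l).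
Proof.
  intros H Hx Hlt; induction l as [|y l IH]; [destruct Hx|].
  simpl; pose proof (H y); destruct Hx as [->|Hx].
  - pose proof (list_sum_le f g l H); lia.
  - specialize (IH Hx); lia.
Qed.

Lemma count_mono P v n : count P v n <= count P v (S n).
Proof.
  revert v; induction n as [|n IH]; intros v.
  - rewrite countS; simpl count at 1; lia.
  - rewrite (countS P v (S n)), (countS P v n); apply Nat.add_le_mono_l, list_sum_le; intros; apply IH.
Qed.

Lemma count_pos P v : P v = true -> forall n, 0 < count P v n.
Proof. intros H [|n]; simpl; rewrite H; simpl; lia. Qed.

Lemma count_hit P v n w : desc v (S n) w -> P w = true -> count P v n < count P v (S n).
Proof.
  revert v; induction n as [|n IH]; intros v Hd Hw;
    destruct (desc_succ _ _ _ Hd) as (j & Hj & Hd').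
  - apply desc0 in Hd'; subst w.
    rewrite countS; simpl count at 1.
    apply Nat.add_lt_mono_l.
    apply Nat.le_lt_trans with (list_sum (map (fun _ : nat => 0) (seq 0 16))); [simpl; lia|].
    apply list_sum_lt with j; [lia | apply in_seq; lia | apply count_pos; exact Hw].
  - rewrite (countS P v (S n)), (countS P v n); apply Nat.add_lt_mono_l.
    apply list_sum_lt with j; [intros; apply count_mono | apply in_seq; lia |].
    apply IH; assumption.
Qed.

(** By [count_hit], every further level that meets [P] makes the count strictly larger. *)
Lemma count_levels P v n :
  (forall t, t <= n -> exists w, desc v t w /\ P w = true) -> n < count P v n.
Proof.
  induction n as [|n IH]; intros H.
  - destruct (H 0 (le_n 0)) as (w & Hd & Hw).
    apply desc0 in Hd; subst w; apply count_pos, Hw.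
  - destruct (H (S n) (le_n _)) as (w & Hd & Hw).
    pose proof (count_hit P v n w Hd Hw); specialize (IH ltac:(intros; apply H; lia)); lia.
Qed.

Definition bounded_list_below (good : nat * nat -> Prop) (v : nat * nat) (D : nat) (A : list (nat * nat)) : Prop :=
  NoDup A /\ forall w, In w A -> good w /\ exists t, t <= D /\ desc v t w.

Lemma list_below_child good v j D A : j < 16 ->
  bounded_list_below good (child v j) D A -> bounded_list_below good v (S D) A.
Proof.
  intros Hj [H1 H2]; split; [exact H1|].
  intros w Hw; destruct (H2 w Hw) as (Hg & t & Ht & Hd); split; [exact Hg|].
  exists (S t); split; [lia | apply desc_child with j; assumption].
Qed.

Lemma list_below_mono good v D D' A : D <= D' ->
  bounded_list_below good v D A -> bounded_list_below good v D' A.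
Proof.
  intros HD [H1 H2]; split; [exact H1|].
  intros w Hw; destruct (H2 w Hw) as (Hg & t & Ht & Hd); split; [exact Hg|].
  exists t; split; [lia | exact Hd].
Qed.

(** Subtrees of different children are disjoint, so the lists can be concatenated. Each child with
    [s j > 0] contributes a surplus of [b], whence the number of such children in the bound. The
    last conclusion leaves the subtrees with [s j = 0] free for a further list. *)
Lemma list_below_children good v D b (s : nat -> nat) js :
  NoDup js -> (forall j, In j js -> j < 16) ->
  (forall j, In j js -> 0 < s j ->
     exists A, bounded_list_below good (child v j) D A /\ b * (s j + 1) <= 2 * length A) ->
  exists A, bounded_list_below good v (S D) A /\
    b * (list_sum (map s js) + length (filter (fun j => 0 <? s j) js)) <= 2 * length A /\
    forall w, In w A -> exists j t, In j js /\ 0 < s j /\ desc (child v j) t w.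
Proof.
  intros Hjs; induction Hjs as [|j js Hj Hjs IH]; intros H16 H.
  - exists nil; split; [split; [constructor | intros w []]|]; split; [simpl; lia | intros w []].
  - destruct IH as (A & HA & Hlen & Hch); [intros; apply H16; right; assumption |
      intros; apply H; [right|]; assumption |].
    simpl map; cbn [filter list_sum fold_right].
    change (fold_right Init.Nat.add 0 (map s js)) with (list_sum (map s js)).
    destruct (Nat.ltb_spec 0 (s j)) as [Hs|Hs].
    + destruct (H j (or_introl eq_refl) Hs) as (A' & HA' & Hlen').
      exists (A' ++ A); split; [|split].
      * destruct (list_below_child _ _ _ _ _ (H16 j (or_introl eq_refl)) HA') as [_ HB'].
        destruct HA as [HA1 HA2], HA' as [HA'1 HA'2]; split.
        -- apply NoDup_app; [assumption | assumption |].
           intros w Hw Hw'; destruct (HA'2 w Hw) as (_ & t & _ & Hd).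
           destruct (Hch w Hw') as (j' & t' & Hj' & _ & Hd').
           assert (j = j') by (eapply desc_child_inj; eassumption); subst j'; contradiction.
        -- intros w Hw; apply in_app_iff in Hw; destruct Hw as [Hw|Hw]; auto.
      * rewrite length_app; simpl length; nia.
      * intros w Hw; apply in_app_iff in Hw; destruct Hw as [Hw|Hw].
        -- destruct HA' as [_ HA'2]; destruct (HA'2 w Hw) as (_ & t & _ & Hd).
           exists j, t; split; [left; reflexivity | split; assumption].
        -- destruct (Hch w Hw) as (j' & t' & Hj' & Hs' & Hd').
           exists j', t'; split; [right; assumption | split; assumption].
    + exists A; split; [exact HA|]; split; [replace (s j) with 0 by lia; simpl; lia|].
      intros w Hw; destruct (Hch w Hw) as (j' & t' & Hj' & Hs' & Hd').
      exists j', t'; split; [right; assumption | split; assumption].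
Qed.

Lemma filter_pos_of_sum (s : nat -> nat) js :
  0 < list_sum (map s js) -> 0 < length (filter (fun j => 0 <? s j) js).
Proof.
  induction js as [|j js IH]; [simpl; lia|].
  simpl; destruct (Nat.ltb_spec 0 (s j)); simpl; [lia|].
  replace (s j) with 0 by lia; exact IH.
Qed.

Lemma filter_pos_two (s : nat -> nat) i j js :
  0 < s i -> 0 < s j -> 2 <= length (filter (fun j => 0 <? s j) (i :: j :: js)).
Proof.
  intros Hi Hj; cbn [filter].
  apply Nat.ltb_lt in Hi, Hj; rewrite Hi, Hj; simpl; lia.
Qed.

(* At least half of the vertices of [P] are either tops of pairwise disjoint
   subtrees or have a child whose subtree is free of [P]; so lists of length
   [b] found below every vertex of [P] and every child of one can be collected
   without overlap. *)
Lemma collect_below (P : nat * nat -> bool) good b D :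
  (forall c, (P c = true \/ exists p j, j < 16 /\ P p = true /\ c = child p j) ->
     exists A, bounded_list_below good c D A /\ b <= length A) ->
  forall n v, 0 < count P v n ->
  exists A, bounded_list_below good v (n + 1 + D) A /\ b * (count P v n + 1) <= 2 * length A.
Proof.
  intros H; induction n as [|n IH]; intros v Hv.
  - simpl in *; destruct (P v) eqn:HP; simpl in *; [|lia].
    destruct (H v (or_introl HP)) as (A & HA & Hlen).
    exists A; split; [apply list_below_mono with D; [lia | exact HA] | lia].
  - rewrite countS in *.
    set (s := fun j => count P (child v j) n) in *.
    destruct (list_below_children good v (n + 1 + D) b s (seq 0 16)) as (A & HA & Hlen & Hch).
    { apply seq_NoDup. }
    { intros j Hj; apply in_seq in Hj; lia. }
    { intros j _ Hs; apply IH, Hs. }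
    change (S (n + 1 + D)) with (S n + 1 + D) in HA.
    set (c := list_sum (map s (seq 0 16))) in *.
    pose proof (filter_pos_of_sum s (seq 0 16)) as Hpos; fold c in Hpos.
    set (k := length (filter (fun j => 0 <? s j) (seq 0 16))) in *.
    destruct (P v) eqn:HP; simpl Nat.b2n in *.
    2: { exists A; split; [exact HA|]; specialize (Hpos ltac:(lia)); nia. }
    (* With [v] itself in [P] the target is [b * (c + 2)]. Two children that contain vertices of [P]
       already give this surplus; otherwise child 0 or child 1 is free of [P] and can host a list of
       its own. *)
    assert (Hk : 2 <= k \/ exists j, j < 16 /\ s j = 0).
    { destruct (Nat.eq_dec (s 0) 0) as [E|E0]; [right; exists 0; split; [lia | exact E]|].
      destruct (Nat.eq_dec (s 1) 0) as [E|E1]; [right; exists 1; split; [lia | exact E]|].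
      left; apply (filter_pos_two s 0 1 (seq 2 14)); lia. }
    destruct Hk as [Hk | (j & Hj & Hs)]; [exists A; split; [exact HA | nia]|].
    destruct (H (child v j)) as (A' & HA' & Hlen').
    { right; exists v, j; repeat split; assumption. }
    exists (A' ++ A); split.
    + destruct (list_below_child _ _ _ _ _ Hj HA') as [_ HB'].
      destruct HA as [HA1 HA2], HA' as [HA'1 HA'2]; split.
      * apply NoDup_app; [assumption | assumption |].
        intros w Hw Hw'; destruct (HA'2 w Hw) as (_ & t & _ & Hd).
        destruct (Hch w Hw') as (j' & t' & _ & Hs' & Hd').
        assert (j = j') by (eapply desc_child_inj; eassumption); subst j'; lia.
      * intros w Hw; apply in_app_iff in Hw; destruct Hw as [Hw|Hw]; [|auto].
        destruct (HB' w Hw) as (Hg & t & Ht & Hd); split; [exact Hg|].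
        exists t; split; [lia | exact Hd].
    + rewrite length_app.
      assert (0 < k \/ c = 0) as [Hk|Hc] by (destruct c; [right; reflexivity | left; apply Hpos; lia]); nia.
Qed.

Open Scope R_scope.

(** * The hyperbolic distance *)

Definition cosh_hdist (p q : pt) : R :=
  1 + ((fst p - fst q) ^ 2 + (snd p - snd q) ^ 2) / (2 * snd p * snd q).

Lemma cosh_hdist_ge1 p q : inH2 p -> inH2 q -> 1 <= cosh_hdist p q.
Proof.
  unfold inH2, cosh_hdist; intros Hp Hq.
  assert (0 <= ((fst p - fst q) ^ 2 + (snd p - snd q) ^ 2) / (2 * snd p * snd q)); [|lra].
  pose proof (pow2_ge_0 (fst p - fst q)); pose proof (pow2_ge_0 (snd p - snd q)).
  apply Rle_mult_inv_pos; nra.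
Qed.

Lemma hdist_exp p q : inH2 p -> inH2 q ->
  let t := cosh_hdist p q in exp (hdist p q) = t + sqrt (t ^ 2 - 1).
Proof.
  intros Hp Hq t; pose proof (cosh_hdist_ge1 p q Hp Hq).
  change (hdist p q) with (ln (t + sqrt (t ^ 2 - 1))).
  apply exp_ln; pose proof (sqrt_pos (t ^ 2 - 1)); subst t; lra.
Qed.

Lemma hdist_exp_opp p q : inH2 p -> inH2 q ->
  let t := cosh_hdist p q in exp (- hdist p q) = t - sqrt (t ^ 2 - 1).
Proof.
  intros Hp Hq t; pose proof (cosh_hdist_ge1 p q Hp Hq).
  rewrite exp_Ropp, hdist_exp by assumption; fold t.
  assert (Hs : sqrt (t ^ 2 - 1) * sqrt (t ^ 2 - 1) = t ^ 2 - 1) by (apply sqrt_sqrt; subst t; nra).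
  pose proof (sqrt_pos (t ^ 2 - 1)).
  assert (t + sqrt (t ^ 2 - 1) <> 0) by (subst t; lra).
  apply (Rmult_eq_reg_l (t + sqrt (t ^ 2 - 1))); [|assumption].
  rewrite Rinv_r by assumption; nra.
Qed.

Lemma cosh_hdistE p q : inH2 p -> inH2 q -> cosh (hdist p q) = cosh_hdist p q.
Proof.
  intros Hp Hq; unfold cosh; rewrite hdist_exp, hdist_exp_opp by assumption; lra.
Qed.

Lemma sinh_hdistE p q : inH2 p -> inH2 q ->
  sinh (hdist p q) = sqrt (cosh_hdist p q ^ 2 - 1).
Proof.
  intros Hp Hq; unfold sinh; rewrite hdist_exp, hdist_exp_opp by assumption; lra.
Qed.

Lemma exp_le_mono x y : x <= y -> exp x <= exp y.
Proof.
  intros [H | ->]; [left; apply exp_increasing; exact H | lra].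
Qed.

Lemma hdist_ge0 p q : inH2 p -> inH2 q -> 0 <= hdist p q.
Proof.
  intros Hp Hq; destruct (Rle_or_lt 0 (hdist p q)) as [H|H]; [exact H|].
  apply exp_increasing in H; rewrite exp_0, hdist_exp in H by assumption.
  pose proof (cosh_hdist_ge1 p q Hp Hq); pose proof (sqrt_pos (cosh_hdist p q ^ 2 - 1)); lra.
Qed.

Lemma cosh_lt_mono a b : 0 <= a -> a < b -> cosh a < cosh b.
Proof.
  intros Ha Hab; unfold cosh; rewrite !exp_Ropp.
  pose proof (exp_increasing a b Hab) as H.
  assert (1 <= exp a) by (rewrite <- exp_0; apply exp_le_mono; lra).
  set (u := exp a) in *; set (v := exp b) in *.
  assert (v + / v - (u + / u) = (v - u) * (u * v - 1) / (u * v)) by (field; lra).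
  assert (0 < (v - u) * (u * v - 1) / (u * v)); [|lra].
  apply Rdiv_lt_0_compat; [|nra]; apply Rmult_lt_0_compat; nra.
Qed.

Lemma cosh_le_mono a b : 0 <= a -> a <= b -> cosh a <= cosh b.
Proof. intros Ha [H | ->]; [left; apply cosh_lt_mono; assumption | lra]. Qed.

Lemma hdist_leP p q D : inH2 p -> inH2 q -> 0 <= D ->
  cosh_hdist p q <= cosh D -> hdist p q <= D.
Proof.
  intros Hp Hq HD H; rewrite <- cosh_hdistE in H by assumption.
  destruct (Rle_or_lt (hdist p q) D) as [H'|H']; [exact H'|].
  apply cosh_lt_mono in H'; lra.
Qed.

Lemma hdist_geP p q D : inH2 p -> inH2 q ->
  cosh D <= cosh_hdist p q -> D <= hdist p q.
Proof.
  intros Hp Hq H; rewrite <- cosh_hdistE in H by assumption.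
  destruct (Rle_or_lt D (hdist p q)) as [H'|H']; [exact H'|].
  apply cosh_lt_mono in H'; [lra | apply hdist_ge0; assumption].
Qed.

Lemma hdist_le_ln p q K : inH2 p -> inH2 q ->
  cosh_hdist p q <= K -> hdist p q <= ln (2 * K).
Proof.
  intros Hp Hq H; pose proof (cosh_hdist_ge1 p q Hp Hq).
  assert (0 <= ln (2 * K)) by (rewrite <- ln_1; left; apply ln_increasing; lra).
  apply hdist_leP; try assumption.
  unfold cosh; rewrite exp_Ropp, exp_ln by lra.
  assert (0 < / (2 * K)) by (apply Rinv_0_lt_compat; lra); lra.
Qed.

Lemma hdist_refl p : inH2 p -> hdist p p = 0.
Proof.
  intros Hp; apply Rle_antisym; [|apply hdist_ge0; assumption].
  apply hdist_leP; try assumption; [lra|].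
  unfold cosh_hdist, inH2 in *; rewrite cosh_0; right; field; lra.
Qed.

Lemma hdist_sym p q : inH2 p -> inH2 q -> hdist p q = hdist q p.
Proof.
  intros Hp Hq.
  assert (E : cosh_hdist p q = cosh_hdist q p)
    by (unfold cosh_hdist, inH2 in *; field; lra).
  unfold hdist; fold (cosh_hdist p q) (cosh_hdist q p); rewrite E; reflexivity.
Qed.

(* [cosh_hdist] is minus the Lorentzian inner product in the hyperboloid model,
   so the Gram determinant of three points is a square. *)
Lemma gram_ge0 p q r : inH2 p -> inH2 q -> inH2 r ->
  let a := cosh_hdist p q in let b := cosh_hdist q r in let c := cosh_hdist p r in
  0 <= 1 + 2 * a * b * c - a ^ 2 - b ^ 2 - c ^ 2.
Proof.
  destruct p as [x1 y1], q as [x2 y2], r as [x3 y3]; intros H1 H2 H3 a b c.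
  unfold inH2 in *; simpl in H1, H2, H3.
  set (D := (x1 ^ 2 + y1 ^ 2) * (x3 - x2) + (x2 ^ 2 + y2 ^ 2) * (x1 - x3)
            + (x3 ^ 2 + y3 ^ 2) * (x2 - x1)).
  replace (1 + 2 * a * b * c - a ^ 2 - b ^ 2 - c ^ 2)
    with ((D / (2 * y1 * y2 * y3)) ^ 2)
    by (unfold a, b, c, D, cosh_hdist; simpl fst; simpl snd; field; lra).
  apply pow2_ge_0.
Qed.

(** With [a], [b], [c] the three hyperbolic cosines, the Gram determinant equals
    [(a^2 - 1) * (b^2 - 1) - (c - a * b)^2]. Its being nonnegative gives [c <= a * b + u * v], where
    [u] and [v] are the hyperbolic sines, and the right side is the addition formula for cosh. *)
Lemma hdist_triangle p q r : inH2 p -> inH2 q -> inH2 r ->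
  hdist p r <= hdist p q + hdist q r.
Proof.
  intros Hp Hq Hr.
  pose proof (hdist_ge0 p q Hp Hq); pose proof (hdist_ge0 q r Hq Hr).
  apply hdist_leP; try assumption; [lra|].
  assert (E : forall u v, cosh (u + v) = cosh u * cosh v + sinh u * sinh v).
  { intros u v; unfold cosh, sinh; rewrite Ropp_plus_distr, !exp_plus; field. }
  rewrite E, !cosh_hdistE, !sinh_hdistE by assumption.
  pose proof (gram_ge0 p q r Hp Hq Hr) as G; cbv zeta in G.
  pose proof (cosh_hdist_ge1 p q Hp Hq); pose proof (cosh_hdist_ge1 q r Hq Hr).
  set (a := cosh_hdist p q) in *; set (b := cosh_hdist q r) in *; set (c := cosh_hdist p r) in *.
  assert (Ha : sqrt (a ^ 2 - 1) * sqrt (a ^ 2 - 1) = a ^ 2 - 1) by (apply sqrt_sqrt; nra).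
  assert (Hb : sqrt (b ^ 2 - 1) * sqrt (b ^ 2 - 1) = b ^ 2 - 1) by (apply sqrt_sqrt; nra).
  pose proof (sqrt_pos (a ^ 2 - 1)); pose proof (sqrt_pos (b ^ 2 - 1)).
  set (u := sqrt (a ^ 2 - 1)) in *; set (v := sqrt (b ^ 2 - 1)) in *.
  assert (Huv : 0 <= u * v) by nra.
  assert (Hsq : (c - a * b) ^ 2 <= (u * v) ^ 2).
  { replace ((u * v) ^ 2) with ((u * u) * (v * v)) by ring; rewrite Ha, Hb; nra. }
  destruct (Rle_or_lt (c - a * b) (u * v)) as [L|L]; [lra | nra].
Qed.

Lemma hdist_ge_vert p q r E : inH2 p -> inH2 q -> exp r <= E -> E * snd p <= snd q ->
  0 <= r -> r <= hdist p q.
Proof.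
  intros Hp Hq HE H Hr; apply hdist_geP; try assumption.
  unfold inH2, cosh_hdist, cosh in *; rewrite exp_Ropp.
  assert (1 <= exp r) by (rewrite <- exp_0; apply exp_le_mono; lra).
  set (e := exp r) in *; set (y := snd p) in *; set (y' := snd q) in *.
  assert (e * y <= y') by nra.
  assert (Hx : 0 <= (fst p - fst q) ^ 2 / (2 * y * y')) by (apply Rle_mult_inv_pos; [apply pow2_ge_0 | nra]).
  (* The excess over [cosh r] splits into a horizontal square and a product whose factors are
     nonnegative once [e * y <= y']. *)
  assert (1 + ((fst p - fst q) ^ 2 + (y - y') ^ 2) / (2 * y * y') - (e + / e) / 2
          = (fst p - fst q) ^ 2 / (2 * y * y')
            + (y' - e * y) * (y' * e - y) / (2 * y * y' * e)) by (field; lra).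
  assert (0 <= (y' - e * y) * (y' * e - y) / (2 * y * y' * e)); [|lra].
  apply Rle_mult_inv_pos; [|repeat apply Rmult_lt_0_compat; lra].
  apply Rmult_le_pos; nra.
Qed.

Lemma cosh_hdist_ge_horiz p q A : inH2 p -> inH2 q -> 0 <= A ->
  A * snd p <= Rabs (fst p - fst q) -> A * snd q <= Rabs (fst p - fst q) ->
  1 + A ^ 2 / 2 <= cosh_hdist p q.
Proof.
  unfold inH2, cosh_hdist; intros Hp Hq HA H1 H2.
  set (y := snd p) in *; set (y' := snd q) in *.
  assert (Hx : A ^ 2 * (y * y') <= (fst p - fst q) ^ 2).
  { rewrite <- (pow2_abs (fst p - fst q)).
    replace (A ^ 2 * (y * y')) with ((A * y) * (A * y')) by ring.
    replace (Rabs (fst p - fst q) ^ 2) with (Rabs (fst p - fst q) * Rabs (fst p - fst q)) by ring.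
    apply Rmult_le_compat; nra. }
  apply Rplus_le_compat_l, (Rmult_le_reg_r (2 * y * y')); [nra|].
  replace (((fst p - fst q) ^ 2 + (y - y') ^ 2) / (2 * y * y') * (2 * y * y'))
    with ((fst p - fst q) ^ 2 + (y - y') ^ 2) by (field; lra).
  pose proof (pow2_ge_0 (y - y')); nra.
Qed.

Lemma hdist_ge_horiz p q r E : inH2 p -> inH2 q -> 0 <= r -> exp r <= E ->
  E * snd p <= Rabs (fst p - fst q) -> E * snd q <= Rabs (fst p - fst q) ->
  r <= hdist p q.
Proof.
  intros Hp Hq Hr HE H1 H2; apply hdist_geP; try assumption.
  assert (1 <= exp r) by (rewrite <- exp_0; apply exp_le_mono; lra).
  assert (exp (- r) <= 1) by (rewrite <- exp_0; apply exp_le_mono; lra).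
  pose proof (cosh_hdist_ge_horiz p q E Hp Hq ltac:(lra) H1 H2).
  unfold cosh; nra.
Qed.

Lemma cosh_hdist_le_box p q h A B : inH2 p -> inH2 q -> 0 < h ->
  h <= snd p -> h <= snd q -> Rabs (fst p - fst q) <= A * h -> Rabs (snd p - snd q) <= B * h ->
  cosh_hdist p q <= 1 + (A ^ 2 + B ^ 2) / 2.
Proof.
  unfold inH2, cosh_hdist; intros Hp Hq Hh H1 H2 HA HB.
  assert (S : forall u c, Rabs u <= c * h -> u ^ 2 <= c ^ 2 * (snd p * snd q)).
  { intros u c Hc; rewrite <- (pow2_abs u); pose proof (Rabs_pos u).
    apply Rle_trans with ((c * h) ^ 2); [apply pow_incr; lra|].
    replace ((c * h) ^ 2) with (c ^ 2 * (h * h)) by ring.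
    apply Rmult_le_compat_l; [apply pow2_ge_0 | nra]. }
  apply S in HA; apply S in HB.
  apply Rplus_le_compat_l, (Rmult_le_reg_r (2 * snd p * snd q)); [nra|].
  replace (((fst p - fst q) ^ 2 + (snd p - snd q) ^ 2) / (2 * snd p * snd q) * (2 * snd p * snd q))
    with ((fst p - fst q) ^ 2 + (snd p - snd q) ^ 2) by (field; lra).
  nra.
Qed.

(** * Two colours do not suffice *)

Lemma exp_mul_nat x n : exp (INR n * x) = exp x ^ n.
Proof.
  induction n as [|n IH]; [rewrite Rmult_0_l, exp_0; reflexivity|].
  rewrite S_INR, Rmult_plus_distr_r, exp_plus, IH, Rmult_1_l; simpl; ring.
Qed.

(** Raise [x <= c * exp (x / c)] to the power [c], where [c] is the degree. *)
Lemma pow_le_exp d : exists K, 0 <= K /\ forall x, 0 <= x -> x ^ d <= K * exp x.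
Proof.
  destruct d as [|d].
  - exists 1; split; [lra|]; intros x Hx; pose proof (exp_ineq1_le x); simpl; lra.
  - set (c := INR (S d)).
    assert (Hc : 0 < c) by (apply lt_0_INR; lia).
    exists (c ^ S d); split; [apply pow_le; lra|].
    intros x Hx.
    assert (Hy : x <= c * exp (x / c)).
    { pose proof (exp_ineq1_le (x / c)).
      replace x with (c * (x / c)) at 1 by (field; lra).
      apply Rmult_le_compat_l; lra. }
    replace (exp x) with (exp (x / c) ^ S d)
      by (rewrite <- exp_mul_nat; f_equal; fold c; field; lra).
    rewrite <- Rpow_mult_distr; apply pow_incr; lra.
Qed.

(** The polynomial is at most a constant times [4 ^ n], and the constant is at most [2 ^ n] for
    large [n]. The base 8 is the one tolerated by [sparse_marks_miss_column]. *)
Lemma poly_le_pow8 C alpha d : 0 <= alpha ->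
  exists m, forall n, (m <= n)%nat -> C * (alpha * INR n + 2) ^ d + C <= 8 ^ n.
Proof.
  intros Ha; destruct (pow_le_exp d) as (K & HK & Hexp).
  set (R := alpha + 2); set (Q := Rabs C * (R ^ d * (K * 3) + 1)).
  destruct (INR_unbounded Q) as [m Hm].
  exists m; intros n Hn.
  pose proof (pos_INR n) as Hn0.
  assert (H3 : exp (INR n) <= 3 ^ n).
  { rewrite <- (Rmult_1_r (INR n)), exp_mul_nat; apply pow_incr.
    split; [left; apply exp_pos | apply exp_le_3]. }
  assert (H34 : 3 ^ n <= 4 ^ n) by (apply pow_incr; lra).
  assert (H4 : 1 <= 4 ^ n) by (apply pow_R1_Rle; lra).
  assert (HR : 0 <= R ^ d) by (apply pow_le; unfold R; lra).
  assert (Hp0 : 0 <= (alpha * INR n + 2) ^ d) by (apply pow_le; nra).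
  assert (Hp : (alpha * INR n + 2) ^ d <= R ^ d * (K * 3) * 4 ^ n).
  { apply Rle_trans with ((R * (INR n + 1)) ^ d); [apply pow_incr; unfold R; nra|].
    rewrite Rpow_mult_distr, Rmult_assoc; apply Rmult_le_compat_l; [exact HR|].
    eapply Rle_trans; [apply Hexp; lra|].
    rewrite exp_plus, Rmult_assoc; apply Rmult_le_compat_l; [exact HK|].
    pose proof exp_le_3; pose proof (exp_pos 1); pose proof (exp_pos (INR n)); nra. }
  assert (Hlin : INR n <= 2 ^ n).
  { left; replace 2 with (INR 2) by reflexivity; rewrite <- pow_INR; apply lt_INR.
    apply Nat.pow_gt_lin_r; lia. }
  assert (Q <= 2 ^ n) by (apply le_INR in Hn; lra).
  replace (8 ^ n) with (2 ^ n * 4 ^ n) by (rewrite <- Rpow_mult_distr; f_equal; lra).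
  apply Rle_trans with (Q * 4 ^ n); [|apply Rmult_le_compat_r; lra].
  pose proof (Rle_abs C); pose proof (Rabs_pos C); unfold Q.
  apply Rle_trans with (Rabs C * ((alpha * INR n + 2) ^ d + 1)); [nra|].
  rewrite Rmult_assoc; apply Rmult_le_compat_l; nra.
Qed.

(** * The 16-ary plane tree inside the half-plane *)

(** The spacing 3 and the ratio 16 are large enough to keep distinct centers at distance at least 2,
    so that points chosen within distance 1 of them remain distinct. *)
Definition center (v : nat * nat) : pt := (3 * INR (snd v) / 16 ^ fst v, / 16 ^ fst v).

Lemma center_inH2 v : inH2 (center v).
Proof. apply Rinv_0_lt_compat, pow_lt; lra. Qed.

(** In units of the lower height [/ 16 ^ S n], an edge of the graph starting at level [n] moves
    horizontally by at most 48 and vertically by at most 15. *)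
Definition edge_length : R := ln (2 * (1 + (48 ^ 2 + 15 ^ 2) / 2)).

Lemma edge_length_ge0 : 0 <= edge_length.
Proof. unfold edge_length; rewrite <- ln_1; left; apply ln_increasing; lra. Qed.

Lemma center_edge n m a b :
  (m = n \/ m = S n) ->
  Rabs (3 * INR a / 16 ^ n - 3 * INR b / 16 ^ m) <= 48 * / 16 ^ S n ->
  hdist (center (n, a)) (center (m, b)) <= edge_length.
Proof.
  intros Hm Hx.
  assert (H16 : 0 < 16 ^ n) by (apply pow_lt; lra).
  assert (Hh : 0 < / 16 ^ n) by (apply Rinv_0_lt_compat, H16).
  apply hdist_le_ln; [apply center_inH2 | apply center_inH2 |].
  assert (HS : / 16 ^ S n = / 16 ^ n / 16) by (simpl; field; lra).
  apply cosh_hdist_le_box with (/ 16 ^ S n); try apply center_inH2;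
    unfold center; cbn [fst snd]; try exact Hx; rewrite ?HS; try lra;
    destruct Hm as [-> | ->]; rewrite ?HS; try lra; apply Rabs_le; lra.
Qed.

Lemma center_horizontal n a : hdist (center (n, a)) (center (n, S a)) <= edge_length.
Proof.
  assert (0 < 16 ^ n) by (apply pow_lt; lra).
  apply center_edge; [left; reflexivity|].
  replace (3 * INR a / 16 ^ n - 3 * INR (S a) / 16 ^ n) with (- (48 * / 16 ^ S n))
    by (rewrite S_INR; simpl; field; lra).
  rewrite Rabs_Ropp, Rabs_pos_eq; [lra|].
  apply Rmult_le_pos; [lra | left; apply Rinv_0_lt_compat; simpl; lra].
Qed.

Lemma center_child v j : (j < 16)%nat -> hdist (center v) (center (child v j)) <= edge_length.
Proof.
  destruct v as [n a]; intros Hj; unfold child; cbn [fst snd].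
  assert (0 < 16 ^ n) by (apply pow_lt; lra).
  apply center_edge; [right; reflexivity|].
  apply lt_INR in Hj; replace (INR 16) with 16 in Hj by (simpl; ring); pose proof (pos_INR j).
  assert (0 < / 16 ^ S n) by (apply Rinv_0_lt_compat; simpl; lra).
  replace (3 * INR a / 16 ^ n - 3 * INR (16 * a + j) / 16 ^ S n) with (- (3 * INR j * / 16 ^ S n)).
  2: { rewrite plus_INR, mult_INR; replace (INR 16) with 16 by (simpl; ring); simpl; field; lra. }
  rewrite Rabs_Ropp, Rabs_pos_eq by nra; nra.
Qed.

Lemma center_diagonal n a :
  hdist (center (n, S a)) (center (S n, (16 * a + 15)%nat)) <= edge_length.
Proof.
  assert (0 < 16 ^ n) by (apply pow_lt; lra).
  apply center_edge; [right; reflexivity|].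
  assert (0 < / 16 ^ S n) by (apply Rinv_0_lt_compat; simpl; lra).
  replace (3 * INR (S a) / 16 ^ n - 3 * INR (16 * a + 15) / 16 ^ S n) with (3 * / 16 ^ S n).
  2: { rewrite plus_INR, mult_INR, S_INR; replace (INR 16) with 16 by (simpl; ring);
       replace (INR 15) with 15 by (simpl; ring); simpl; field; lra. }
  rewrite Rabs_pos_eq by lra; lra.
Qed.

Lemma center_desc v t w : desc v t w -> hdist (center v) (center w) <= edge_length * INR t.
Proof.
  revert v; induction t as [|t IH]; intros v Hd.
  - apply desc0 in Hd; subst w; rewrite hdist_refl by apply center_inH2; simpl; lra.
  - destruct (desc_succ _ _ _ Hd) as (j & Hj & Hd').
    pose proof (hdist_triangle (center v) (center (child v j)) (center w)
      (center_inH2 _) (center_inH2 _) (center_inH2 _)).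
    pose proof (center_child v j Hj); apply IH in Hd'; rewrite S_INR; lra.
Qed.

(** On different levels the heights have ratio at least 16, which exceeds [exp 2]; on the same level
    the horizontal gap is at least 3 times the height, which makes the hyperbolic cosine at least
    [1 + 9 / 2]. *)
Lemma center_separated v w : v <> w -> 2 <= hdist (center v) (center w).
Proof.
  assert (He : exp 2 <= 9).
  { replace 2 with (1 + 1) by ring; rewrite exp_plus.
    pose proof exp_le_3; pose proof (exp_pos 1); nra. }
  assert (Hlev : forall v w, (fst v < fst w)%nat -> 2 <= hdist (center w) (center v)).
  { clear v w; intros [n a] [m b]; cbn [fst snd]; intros Hlt.
    apply hdist_ge_vert with 16; try apply center_inH2; try lra.
    unfold center; cbn [fst snd].
    assert (0 < 16 ^ n) by (apply pow_lt; lra).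
    assert (0 < / 16 ^ n) by (apply Rinv_0_lt_compat; lra).
    replace m with (S n + (m - S n))%nat by lia.
    rewrite pow_add, Rinv_mult; simpl (16 ^ S n); rewrite Rinv_mult.
    assert (1 <= 16 ^ (m - S n)) by (apply pow_R1_Rle; lra).
    assert (/ 16 ^ (m - S n) <= 1) by (rewrite <- Rinv_1; apply Rinv_le_contravar; lra).
    nra. }
  intros Hne; destruct (Nat.lt_trichotomy (fst v) (fst w)) as [H|[H|H]].
  - rewrite hdist_sym by apply center_inH2; apply Hlev, H.
  - destruct v as [n a], w as [m b]; cbn [fst] in H; subst m.
    apply hdist_geP; try apply center_inH2.
    assert (0 < / 16 ^ n) by (apply Rinv_0_lt_compat, pow_lt; lra).
    assert (Hab : 1 <= Rabs (INR a - INR b)).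
    { destruct (Nat.lt_trichotomy a b) as [L|[L|L]]; [|congruence|];
        apply le_INR in L; rewrite S_INR in L; unfold Rabs; destruct (Rcase_abs _); lra. }
    assert (Hx : 3 * / 16 ^ n <= Rabs (fst (center (n, a)) - fst (center (n, b)))).
    { unfold center; cbn [fst snd].
      replace (3 * INR a / 16 ^ n - 3 * INR b / 16 ^ n) with (3 * / 16 ^ n * (INR a - INR b))
        by (field; apply pow_nonzero; lra).
      rewrite Rabs_mult, (Rabs_pos_eq (3 * / 16 ^ n)) by lra; nra. }
    pose proof (cosh_hdist_ge_horiz (center (n, a)) (center (n, b)) 3
      (center_inH2 _) (center_inH2 _) ltac:(lra) Hx Hx).
    unfold cosh; rewrite exp_Ropp.
    assert (1 <= exp 2) by (pose proof (exp_ineq1_le 2); lra).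
    assert (/ exp 2 <= 1) by (rewrite <- Rinv_1; apply Rinv_le_contravar; lra); lra.
  - apply Hlev, H.
Qed.

(** * Chains of neighbouring pieces *)

(** A version of [iter_nbhd] that records the index of the last piece, so that chains can be
    composed. *)
Fixpoint reach {T I : Type} (dist : T -> T -> R) (P : I -> T -> Prop) (valid : I -> Prop)
    (s : R) (m : nat) (l0 l : I) : Prop :=
  match m with
  | O => l = l0
  | S m' => valid l /\ exists l', reach dist P valid s m' l0 l' /\
              exists z p, P l z /\ P l' p /\ dist z p <= s
  end.

Lemma reach_iter_nbhd {T I : Type} (dist : T -> T -> R) P valid s m (l0 l : I) x :
  reach dist P valid s m l0 l -> P l x -> iter_nbhd dist valid P s m (P l0) x.
Proof.
  revert l x; induction m as [|m IH]; intros l x H Hx; simpl in *; [subst; exact Hx|].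
  destruct H as (Hl & l' & Hl' & z & p & Hz & Hp & Hzp).
  exists l; split; [exact Hl|]; split; [exact Hx|].
  exists z; split; [exact Hz|]; exists p; split; [apply IH with l'; assumption | exact Hzp].
Qed.

Lemma reach_trans {T I : Type} (dist : T -> T -> R) P valid s m m' (l0 l1 l2 : I) :
  reach dist P valid s m l0 l1 -> reach dist P valid s m' l1 l2 ->
  reach dist P valid s (m' + m) l0 l2.
Proof.
  intros H; revert l2; induction m' as [|m' IH]; intros l2 H'; simpl in *; [subst; exact H|].
  destruct H' as (Hl & l' & Hl' & Hz); split; [exact Hl|]; exists l'; split; [apply IH, Hl' | exact Hz].
Qed.

Definition piece {J : Type} (Pc : nat -> J -> pt -> Prop) (l : nat * J) : pt -> Prop :=
  Pc (fst l) (snd l).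

Definition valid_piece {J : Type} (k : nat) (l : nat * J) : Prop := (fst l <= k)%nat.

(** Each of the two net points adds at most 1 to the distance of adjacent centers. *)
Definition step_length : R := edge_length + 2.

Definition labelled_net {J : Type} (k : nat) (Pc : nat -> J -> pt -> Prop)
    (net : nat * nat -> pt) (lab : nat * nat -> nat * J) : Prop :=
  forall v, inH2 (net v) /\ hdist (center v) (net v) < 1 /\
    valid_piece k (lab v) /\ piece Pc (lab v) (net v).

Notation reaches Pc k := (reach hdist (piece Pc) (valid_piece k) step_length).

Lemma net_dist {J : Type} k (Pc : nat -> J -> pt -> Prop) net lab u v :
  labelled_net k Pc net lab -> hdist (net u) (net v) <= hdist (center u) (center v) + 2.
Proof.
  intros H; destruct (H u) as (Hu & Hu1 & _), (H v) as (Hv & Hv1 & _).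
  pose proof (hdist_triangle (net u) (center u) (net v) Hu (center_inH2 u) Hv).
  pose proof (hdist_triangle (center u) (center v) (net v) (center_inH2 u) (center_inH2 v) Hv).
  rewrite (hdist_sym (center u) (net u)) in Hu1 by (assumption || apply center_inH2); lra.
Qed.

Lemma net_inj {J : Type} k (Pc : nat -> J -> pt -> Prop) net lab u v :
  labelled_net k Pc net lab -> net u = net v -> u = v.
Proof.
  intros H E; destruct (H u) as (Hu & Hu1 & _), (H v) as (Hv & Hv1 & _).
  destruct (excluded_middle_informative (u = v)) as [|Hne]; [assumption|].
  apply center_separated in Hne.
  pose proof (hdist_triangle (center u) (net v) (center v) (center_inH2 u) Hv (center_inH2 v)).
  rewrite (hdist_sym (center v) (net v)) in Hv1 by (assumption || apply center_inH2).
  rewrite E in Hu1; lra.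
Qed.

Lemma reaches_self {J : Type} k (Pc : nat -> J -> pt -> Prop) net lab v m :
  labelled_net k Pc net lab -> reaches Pc k m (lab v) (lab v).
Proof.
  intros H; destruct (H v) as (Hv & _ & Hval & HP).
  induction m as [|m IH]; simpl; [reflexivity|].
  split; [exact Hval|]; exists (lab v); split; [exact IH|].
  exists (net v), (net v); repeat split; try assumption.
  rewrite hdist_refl by assumption; unfold step_length; pose proof edge_length_ge0; lra.
Qed.

Lemma reaches_child {J : Type} k (Pc : nat -> J -> pt -> Prop) net lab v j :
  labelled_net k Pc net lab -> (j < 16)%nat -> reaches Pc k 1 (lab v) (lab (child v j)).
Proof.
  intros H Hj; simpl; split; [apply H|]; exists (lab v); split; [reflexivity|].
  exists (net (child v j)), (net v); split; [apply H | split; [apply H|]].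
  pose proof (net_dist k Pc net lab (child v j) v H).
  pose proof (center_child v j Hj).
  rewrite hdist_sym in H1 by apply center_inH2; unfold step_length; lra.
Qed.

Lemma reaches_desc {J : Type} k (Pc : nat -> J -> pt -> Prop) net lab v t w m :
  labelled_net k Pc net lab -> desc v t w -> (t <= m)%nat -> reaches Pc k m (lab v) (lab w).
Proof.
  intros H; revert v m; induction t as [|t IH]; intros v m Hd Hm.
  - apply desc0 in Hd; subst w; apply reaches_self with net, H.
  - destruct (desc_succ _ _ _ Hd) as (j & Hj & Hd').
    replace m with ((m - 1) + 1)%nat by lia.
    apply reach_trans with (lab (child v j)); [apply reaches_child with net; assumption|].
    apply IH; [exact Hd' | lia].
Qed.

(** The number [m] comes from the growth of single pieces alone, so it serves all [v] and [T]. If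
    depth [T] were not reached, a blocking piece [B] would meet every column below [v]. It has no
    vertex at depth at most [m], since those are reached, and at most [8 ^ n] at each depth [n > m],
    so some column misses it. *)
Lemma reaches_all_levels {J : Type} k d C (Pc : nat -> J -> pt -> Prop) net lab col :
  labelled_net k Pc net lab ->
  two_coloured col (fun n a => lab (n, a)) ->
  (forall l, valid_piece k l -> growth_at_most hdist (piece Pc l) (fun rho => C * rho ^ d + C)) ->
  exists m, forall v T, exists w, desc v T w /\ reaches Pc k m (lab v) (lab w).
Proof.
  intros Hnet (Hh & Hv & Hd) Hgrowth.
  pose proof edge_length_ge0 as He.
  destruct (poly_le_pow8 C (2 * edge_length) d ltac:(lra)) as [m Hm].
  exists m; intros [n0 a0] T.
  destruct (excluded_middle_informative
    (exists w, desc (n0, a0) T w /\ reaches Pc k m (lab (n0, a0)) (lab w))) as [Hex|Hno]; [exact Hex|].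
  exfalso.
  (* Coordinates relative to the subtree below [(n0, a0)], whose root becomes [(0, 0)]. *)
  set (vert := fun n a => ((n0 + n)%nat, (16 ^ n * a0 + a)%nat)).
  assert (Hvert : forall n a, (a < 16 ^ n)%nat -> desc (n0, a0) n (vert n a)).
  { intros n a Ha; split; [reflexivity|]; cbn [snd vert].
    symmetry; apply Nat.div_unique with a; [exact Ha | reflexivity]. }
  set (f := fun l => if excluded_middle_informative (reaches Pc k m (lab (n0, a0)) l) then false else true).
  assert (Hf : forall l, f l = true -> ~ reaches Pc k m (lab (n0, a0)) l).
  { intros l; unfold f; destruct (excluded_middle_informative _); [discriminate | auto]. }
  destruct (exists_blocking_label f col (fun n a => lab (vert n a)) T) as (B & HB & Hblock).
  - split; [|split]; unfold vert.
    + intros n a; rewrite Nat.add_succ_r; apply Hh.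
    + intros n a j Hj.
      replace (n0 + S n)%nat with (S (n0 + n)) by lia.
      replace (16 ^ S n * a0 + (16 * a + j))%nat with (16 * (16 ^ n * a0 + a) + j)%nat
        by (rewrite Nat.pow_succ_r'; ring).
      apply Hv, Hj.
    + intros n a.
      replace (n0 + S n)%nat with (S (n0 + n)) by lia.
      replace (16 ^ S n * a0 + (16 * a + 15))%nat with (16 * (16 ^ n * a0 + a) + 15)%nat
        by (rewrite Nat.pow_succ_r'; ring).
      rewrite Nat.add_succ_r; apply Hd.
  - unfold f; destruct (excluded_middle_informative _) as [_|H]; [reflexivity|].
    destruct H; apply reaches_desc with net 0%nat; [exact Hnet | apply Hvert; simpl; lia | lia].
  - intros a Ha; unfold f; destruct (excluded_middle_informative _) as [H|_]; [|reflexivity].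
    destruct Hno; exists (vert T a); split; [apply Hvert, Ha | exact H].
  - apply Hf in HB.
    destruct (sparse_marks_miss_column (fun n a => (a < 16 ^ n)%nat /\ lab (vert n a) = B) T)
      as (a & Ha & Hmiss).
    + intros [H0 E]; apply HB; rewrite <- E.
      apply reaches_desc with net 0%nat; [exact Hnet | apply Hvert, H0 | lia].
    + intros n l Hl Hin.
      destruct l as [|a l]; [simpl; lia|].
      destruct (le_lt_dec n m) as [Hnm|Hnm].
      { destruct HB; destruct (Hin a (or_introl eq_refl)) as [Ha <-].
        apply reaches_desc with net n; [exact Hnet | apply Hvert, Ha | exact Hnm]. }
      apply INR_le; rewrite pow_INR; replace (INR 8) with 8 by (simpl; ring).
      eapply Rle_trans; [|apply (Hm n); lia].
      rewrite <- (length_map (fun b => net (vert n b))).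
      destruct (Hin a (or_introl eq_refl)) as [Ha EB].
      assert (HvB : valid_piece k B) by (rewrite <- EB; apply Hnet).
      (* Two vertices at depth [n] are joined through the root of the subtree, hence the factor 2;
         the summand 2 passes from centers to net points. *)
      apply (Hgrowth B HvB (net (vert n a)) (2 * edge_length * INR n + 2)).
      * rewrite <- EB; apply Hnet.
      * pose proof (pos_INR n); nra.
      * apply NoDup_map_NoDup_ForallPairs; [|exact Hl].
        intros x y _ _ E; apply (net_inj k Pc net lab) in E; [|exact Hnet].
        apply (f_equal snd) in E; unfold vert in E; cbn [snd] in E; lia.
      * intros w Hw; apply in_map_iff in Hw; destruct Hw as (b & <- & Hb).
        destruct (Hin b Hb) as [Hb' EB'].
        split; [rewrite <- EB'; apply Hnet|].
        pose proof (net_dist k Pc net lab (vert n a) (vert n b) Hnet).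
        pose proof (hdist_triangle (center (vert n a)) (center (n0, a0)) (center (vert n b))
          (center_inH2 _) (center_inH2 _) (center_inH2 _)).
        pose proof (center_desc _ _ _ (Hvert n a Ha)) as H1.
        pose proof (center_desc _ _ _ (Hvert n b Hb')).
        rewrite hdist_sym in H1 by apply center_inH2; lra.
    + destruct (Hblock a Ha) as (n & Hn & E); apply (Hmiss n Hn); split; [|exact E].
      apply Nat.Div0.div_lt_upper_bound; rewrite <- Nat.pow_add_r.
      replace (T - n + n)%nat with T by lia; exact Ha.
Qed.

(* Each further batch of [m + 1] neighbourhood steps raises the growth degree:
   every vertex reached so far sprouts an independent branch. *)
Lemma reaches_growth {J : Type} k (Pc : nat -> J -> pt -> Prop) net lab m :
  labelled_net k Pc net lab ->
  (forall v T, exists w, desc v T w /\ reaches Pc k m (lab v) (lab w)) ->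
  forall e, exists M, (e <= M)%nat /\ forall N v, (1 <= N)%nat ->
    exists A, bounded_list_below (fun w => reaches Pc k M (lab v) (lab w)) v (2 * N * e) A /\
      (N ^ e <= length A)%nat.
Proof.
  intros Hnet Hlev; induction e as [|e (M & HM & IH)].
  - exists 0%nat; split; [lia|]; intros N v _; exists (v :: nil); split; [|simpl; lia].
    split; [repeat constructor; intros []|].
    intros w [<-|[]]; split; [reflexivity|]; exists 0%nat; split; [lia | apply desc_refl].
  (* The step beyond [m] may be needed to pass from a reached vertex to its child. *)
  - exists (M + S m)%nat; split; [lia|]; intros N v HN.
    set (P := fun c => if excluded_middle_informative (reaches Pc k m (lab v) (lab c)) then true else false).
    assert (HP : forall c, P c = true <-> reaches Pc k m (lab v) (lab c)).
    { intros c; unfold P; destruct (excluded_middle_informative _); intuition discriminate. }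
    (* The [2 * N] levels each contain a reached vertex; half of these vertices yield disjoint
       branches with [N ^ e] vertices each. *)
    assert (Hcount : (2 * N - 1 < count P v (2 * N - 1))%nat).
    { apply count_levels; intros t _; destruct (Hlev v t) as (w & Hw & Hr).
      exists w; split; [exact Hw | apply HP, Hr]. }
    destruct (collect_below P (fun w => reaches Pc k (M + S m) (lab v) (lab w)) (N ^ e) (2 * N * e))
      with (n := (2 * N - 1)%nat) (v := v) as (A & HA & Hlen).
    + intros c Hc.
      assert (Hvc : reaches Pc k (S m) (lab v) (lab c)).
      { destruct Hc as [Hc | (p & j & Hj & Hp & ->)].
        - apply HP in Hc; change (S m) with (1 + m)%nat.
          apply reach_trans with (lab c); [exact Hc | apply reaches_self with net, Hnet].
        - apply HP in Hp; change (S m) with (1 + m)%nat.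
          apply reach_trans with (lab p); [exact Hp | apply reaches_child with net; assumption]. }
      destruct (IH N c HN) as (A & [HA1 HA2] & HA3).
      exists A; split; [|exact HA3]; split; [exact HA1|].
      intros w Hw; destruct (HA2 w Hw) as [Hr Hd]; split; [|exact Hd].
      apply reach_trans with (lab c); assumption.
    + lia.
    + exists A; split; [apply list_below_mono with (2 * N - 1 + 1 + 2 * N * e)%nat; [lia | exact HA]|].
      rewrite Nat.pow_succ_r'; nia.
Qed.

(** Iterating the branching [S d] times gives [N ^ S d] points within a distance linear in [N],
    which for large [N] exceeds any bound of degree [d]. *)
Lemma not_poly_asdim_two_colours d k X :
  max_1_separated X -> (k <= 1)%nat -> ~ poly_asdim_prop hdist X d k.
Proof.
  intros (HX & _ & Hmax) Hk Hprop.
  pose proof edge_length_ge0 as He.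
  (* With pieces of one colour farther apart than [step_length], adjacent vertices of equal colour
     must lie in the same piece. *)
  destruct (Hprop (step_length + 1)) as (J & Pc & Hcover & Hdisj & Hgrowth);
    [unfold step_length; lra|].
  assert (Hex : forall v, exists xl : pt * (nat * J), inH2 (fst xl) /\ hdist (center v) (fst xl) < 1 /\
            valid_piece k (snd xl) /\ piece Pc (snd xl) (fst xl)).
  { intros v.
    assert (Hx : exists x, X x /\ hdist (center v) x < 1).
    { destruct (excluded_middle_informative (X (center v))) as [H|H].
      - exists (center v); split; [exact H|]; rewrite hdist_refl by apply center_inH2; lra.
      - apply Hmax; [apply center_inH2 | exact H]. }
    destruct Hx as (x & Hx & Hd); destruct (proj1 (Hcover x) Hx) as (i & j & Hi & Hp).
    exists (x, (i, j)); repeat split; [apply HX, Hx | exact Hd | exact Hi | exact Hp]. }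
  set (sel := fun v => proj1_sig (constructive_indefinite_description _ (Hex v))).
  set (net := fun v => fst (sel v)); set (lab := fun v => snd (sel v)).
  assert (Hnet : labelled_net k Pc net lab).
  { intros v; exact (proj2_sig (constructive_indefinite_description _ (Hex v))). }
  set (col := fun l : nat * J => Nat.eqb (fst l) 0).
  assert (Hcol : forall u v, hdist (center u) (center v) <= edge_length -> compatible col (lab u) (lab v)).
  { intros u v Huv E.
    destruct (Hnet u) as (_ & _ & Vu & Pu), (Hnet v) as (_ & _ & Vv & Pv).
    pose proof (net_dist k Pc net lab u v Hnet) as Hd.
    destruct (lab u) as [i j], (lab v) as [i' j']; unfold col, valid_piece, piece in *; cbn [fst snd] in *.
    assert (i = i').
    { destruct (Nat.eqb_spec i 0), (Nat.eqb_spec i' 0); try discriminate; lia. }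
    subst i'; f_equal.
    destruct (excluded_middle_informative (j = j')) as [|Hne]; [assumption|].
    destruct (Hdisj i j j' Vu Hne _ _ Pu Pv) as [_ Hr]; unfold step_length in Hr; lra. }
  assert (Htwo : two_coloured col (fun n a => lab (n, a))).
  { split; [|split].
    - intros n a; apply Hcol, center_horizontal.
    - intros n a j Hj; apply Hcol, (center_child (n, a) j Hj).
    - intros n a; apply Hcol, center_diagonal. }
  (* Growth is only given for at least one neighbourhood step, but a piece is contained in its own
     first neighbourhood. *)
  destruct (Hgrowth 1%nat 1 (le_n 1) ltac:(lra)) as [C1 HC1].
  destruct (reaches_all_levels k d C1 Pc net lab col Hnet Htwo) as [m Hm].
  { intros [i j] Hi z rho Hz Hrho l Hl Hin.
    assert (Hself : forall x, piece Pc (i, j) x ->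
      iter_nbhd hdist (fun p : nat * J => (fst p <= k)%nat)
        (fun p : nat * J => Pc (fst p) (snd p)) 1 1 (Pc i j) x).
    { intros x Hx; exists (i, j); split; [exact Hi|]; split; [exact Hx|].
      exists x; split; [exact Hx|]; exists x; split; [exact Hx|].
      rewrite hdist_refl; [lra|]; apply HX, Hcover; exists i, j; split; [exact Hi | exact Hx]. }
    apply (HC1 i j Hi z rho (Hself z Hz) Hrho l Hl).
    intros w Hw; destruct (Hin w Hw) as [H1 H2]; split; [apply Hself, H1 | exact H2]. }
  destruct (reaches_growth k Pc net lab m Hnet Hm (S d)) as (M & HM & HA).
  destruct (Hgrowth M step_length ltac:(lia) ltac:(unfold step_length; lra)) as [C HC].
  set (o := (0%nat, 0%nat)).
  (* For [N >= 1] the radius is at most [Rd * N], so the growth bound is at most [Q * N ^ d]; any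
     [N > Q] contradicts this. *)
  set (Rd := 2 * edge_length * INR (S d) + 2); set (Q := Rabs C * (Rd ^ d + 1)).
  assert (HRd : 2 <= Rd) by (unfold Rd; pose proof (pos_INR (S d)); nra).
  destruct (INR_unbounded Q) as [N HN].
  assert (HQ : 0 <= Q).
  { apply Rmult_le_pos; [apply Rabs_pos|]; assert (0 <= Rd ^ d) by (apply pow_le; lra); lra. }
  assert (HN1 : (1 <= N)%nat).
  { destruct N; [simpl in HN; lra | lia]. }
  destruct (HA N o HN1) as (A & [HA1 HA2] & HA3).
  assert (Hreach : forall w, reaches Pc k M (lab o) (lab w) ->
    iter_nbhd hdist (fun p : nat * J => (fst p <= k)%nat)
      (fun p : nat * J => Pc (fst p) (snd p)) step_length M (Pc (fst (lab o)) (snd (lab o))) (net w)).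
  { intros w Hw; apply (reach_iter_nbhd hdist (piece Pc) (valid_piece k) _ _ _ _ _ Hw), Hnet. }
  set (D := (2 * N * S d)%nat) in *.
  assert (Hlen : INR (length (map net A)) <= C * (edge_length * INR D + 2) ^ d + C).
  { apply (HC (fst (lab o)) (snd (lab o))) with (z := net o).
    - apply Hnet.
    - apply Hreach, reaches_self with net, Hnet.
    - pose proof (pos_INR D); nra.
    - apply NoDup_map_NoDup_ForallPairs; [|exact HA1].
      intros x y _ _ E; apply (net_inj k Pc net lab) in E; assumption.
    - intros x Hx; apply in_map_iff in Hx; destruct Hx as (w & <- & Hw).
      destruct (HA2 w Hw) as (Hr & t & Ht & Hd); split; [apply Hreach, Hr|].
      pose proof (net_dist k Pc net lab o w Hnet); pose proof (center_desc _ _ _ Hd).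
      apply le_INR in Ht; nra. }
  rewrite length_map in Hlen; apply le_INR in HA3; rewrite pow_INR in HA3.
  apply le_INR in HN1; simpl (INR 1) in HN1.
  assert (HND : 1 <= INR N ^ d) by (apply pow_R1_Rle; exact HN1).
  assert (Hrho : (edge_length * INR D + 2) ^ d <= Rd ^ d * INR N ^ d).
  { rewrite <- Rpow_mult_distr; apply pow_incr.
    pose proof (pos_INR D); split; [nra|].
    unfold D, Rd; rewrite !mult_INR; simpl (INR 2); pose proof (pos_INR (S d)); nra. }
  assert (Hrho0 : 0 <= (edge_length * INR D + 2) ^ d)
    by (apply pow_le; pose proof (pos_INR D); nra).
  assert (Hfin : INR N * INR N ^ d <= Q * INR N ^ d).
  { simpl in HA3; eapply Rle_trans; [exact HA3|]; eapply Rle_trans; [exact Hlen|].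
    pose proof (Rle_abs C); pose proof (Rabs_pos C).
    apply Rle_trans with (Rabs C * ((edge_length * INR D + 2) ^ d + 1)); [nra|].
    unfold Q; rewrite Rmult_assoc; apply Rmult_le_compat_l; nra. }
  apply Rmult_le_reg_r in Hfin; lra.
Qed.

(** * Three colours suffice *)

(** The integer power of [N] with exponent [k], which is the height of the bottom of row [k]. *)
Definition row (N : R) (k : Z) : R := exp (IZR k * ln N).

Lemma row_pos N k : 0 < row N k.
Proof. apply exp_pos. Qed.

Lemma row_succ N k : 0 < N -> row N (k + 1) = row N k * N.
Proof.
  intros HN; unfold row; rewrite plus_IZR, Rmult_plus_distr_r, exp_plus, Rmult_1_l, exp_ln by exact HN.
  reflexivity.
Qed.

Lemma row_mono N k k' : 1 <= N -> (k <= k')%Z -> row N k <= row N k'.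
Proof.
  intros HN Hk; apply exp_le_mono, Rmult_le_compat_r; [|apply IZR_le, Hk].
  rewrite <- ln_1; destruct HN as [HN | <-]; [left; apply ln_increasing; lra | lra].
Qed.

Lemma row_exists N y : 1 < N -> 0 < y -> exists k, row N k <= y < row N k * N.
Proof.
  intros HN Hy; assert (Hl : 0 < ln N) by (rewrite <- ln_1; apply ln_increasing; lra).
  set (t := ln y / ln N); exists (Int_part t).
  rewrite <- row_succ by lra; unfold row.
  destruct (base_Int_part t) as [H1 H2].
  assert (Ht : t * ln N = ln y) by (unfold t; field; lra).
  rewrite <- (exp_ln y Hy), <- Ht; split.
  - apply exp_le_mono, Rmult_le_compat_r; lra.
  - apply exp_increasing, Rmult_lt_compat_r; [exact Hl|]; rewrite plus_IZR; lra.
Qed.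

(* Row [k] is cut at height [E * row N k] into a lower zone ([true]) and an upper
   core ([false]).  Colour 1 consists of thin walls, over the integers in the core
   and over the half-integers in the zone; as [N] is odd, a half-integer of row
   [k + 1] is a half-integer of row [k], so walls of adjacent rows are never close. *)
Definition cell (N E W : R) (i : nat) (b : bool) (k j : Z) (p : pt) : Prop :=
  let h := row N k in let xi := fst p / (W * h) in let dl := / (8 * N) in
  (if b then h <= snd p < h * E else h * E <= snd p < h * N) /\
  match i, b with
  | 0%nat, false => IZR j + dl < xi < IZR j + 1 - dl
  | 1%nat, false => IZR j - dl <= xi <= IZR j + dl
  | 1%nat, true => IZR j + / 2 - dl <= xi <= IZR j + / 2 + dl
  | 2%nat, true => IZR j + / 2 + dl < xi < IZR j + / 2 + 1 - dl
  | _, _ => False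
  end.

Lemma cell_cover N E W p : 1 < N -> inH2 p ->
  exists i b k j, (i <= 2)%nat /\ cell N E W i b k j p.
Proof.
  intros HN Hp; destruct (row_exists N (snd p) HN Hp) as [k Hk].
  set (h := row N k) in *; set (xi := fst p / (W * h)); set (dl := / (8 * N)).
  destruct (Rlt_or_le (snd p) (h * E)) as [Hy|Hy].
  (* The shift by [dl] makes each period begin at the left end of a wall. *)
  - set (j := Int_part (xi - / 2 + dl)); destruct (base_Int_part (xi - / 2 + dl)) as [J1 J2]; fold j in J1, J2.
    destruct (Rle_or_lt xi (IZR j + / 2 + dl)) as [Hx|Hx].
    + exists 1%nat, true, k, j; split; [lia|]; unfold cell; cbv zeta; fold h xi dl; lra.
    + exists 2%nat, true, k, j; split; [lia|]; unfold cell; cbv zeta; fold h xi dl; lra.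
  - set (j := Int_part (xi + dl)); destruct (base_Int_part (xi + dl)) as [J1 J2]; fold j in J1, J2.
    destruct (Rle_or_lt xi (IZR j + dl)) as [Hx|Hx].
    + exists 1%nat, false, k, j; split; [lia|]; unfold cell; cbv zeta; fold h xi dl; lra.
    + exists 0%nat, false, k, j; split; [lia|]; unfold cell; cbv zeta; fold h xi dl; lra.
Qed.

Lemma cell_height N E W i b k j p : 1 <= E -> E <= N -> cell N E W i b k j p ->
  row N k <= snd p < row N k * N.
Proof.
  intros HE HN [H _]; pose proof (row_pos N k); destruct b; split; nra.
Qed.

(** A scale-invariant condition in Euclidean coordinates which, for [exp r <= E], forces hyperbolic
    distance at least [r]. *)
Definition separated (E : R) (p q : pt) : Prop :=
  E * snd p <= snd q \/ E * snd q <= snd p \/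
  (E * snd p <= Rabs (fst p - fst q) /\ E * snd q <= Rabs (fst p - fst q)).

Lemma separated_sym E p q : separated E p q -> separated E q p.
Proof.
  unfold separated; rewrite (Rabs_minus_sym (fst q)); tauto.
Qed.

Lemma separated_horiz E p q w c Y : 0 < w ->
  E * snd p <= Y -> E * snd q <= Y -> Y <= w * c ->
  (c <= fst p / w - fst q / w \/ c <= fst q / w - fst p / w) -> separated E p q.
Proof.
  intros Hw H1 H2 HY Hd; right; right.
  assert (Hc : w * c <= Rabs (fst p - fst q)); [|lra].
  replace (fst p - fst q) with (w * (fst p / w - fst q / w)) by (field; lra).
  rewrite Rabs_mult, (Rabs_pos_eq w) by lra; apply Rmult_le_compat_l; [lra|].
  set (u := fst p / w) in *; set (v := fst q / w) in *.
  unfold Rabs; destruct (Rcase_abs _); lra.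
Qed.

Lemma IZR_sep j j' : j <> j' -> 1 <= IZR j - IZR j' \/ 1 <= IZR j' - IZR j.
Proof.
  intros H; rewrite <- !minus_IZR.
  destruct (Z.lt_total j j') as [L|[L|L]]; [right | contradiction | left]; apply IZR_le; lia.
Qed.

(** The heights alone suffice unless the rows are adjacent, the lower cell is in a core and the
    upper one in a zone. Equal colours then mean two walls. In units of the lower row their axes are
    at [j] and at [N * (j' + / 2)], an integer and a half-integer, hence at least [/ 2] apart; the
    half-widths [dl] and [N * dl = / 8] leave a gap of more than [/ 4]. *)
Lemma cell_separated_below e i b k j p b' k' j' q :
  (1 <= e)%Z -> let E := IZR e in let N := 2 * E ^ 2 + 1 in let W := 4 * E * N ^ 2 in
  (k < k')%Z -> cell N E W i b k j p -> cell N E W i b' k' j' q -> separated E p q.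
Proof.
  intros He E N W Hk Hp Hq.
  assert (HE : 1 <= E) by (apply IZR_le, He).
  assert (HEN : E <= N) by (unfold N; nra).
  assert (HE2 : E * E <= N) by (unfold N; nra).
  pose proof (cell_height _ _ _ _ _ _ _ _ HE HEN Hp) as Hyp.
  pose proof (cell_height _ _ _ _ _ _ _ _ HE HEN Hq) as Hyq.
  pose proof (row_pos N k) as Hh.
  assert (H1 : row N (k + 1) = row N k * N) by (apply row_succ; lra).
  destruct (Z.eq_dec k' (k + 1)) as [->|Hne].
  2: { left.
       assert (H2 : row N (k + 1 + 1) = row N k * N * N) by (rewrite row_succ, H1 by lra; ring).
       pose proof (row_mono N (k + 1 + 1) k' ltac:(lra) ltac:(lia)).
       apply Rle_trans with (row N k * N * N); [|lra].
       rewrite (Rmult_comm _ N); apply Rmult_le_compat; lra. }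
  set (h := row N k) in *.
  destruct Hp as [Hp1 Hp2], Hq as [Hq1 Hq2]; fold h in Hp1, Hp2; rewrite H1 in *.
  destruct b; [left; nra|].
  destruct b'; [|left; nra].
  assert (Hi : i = 1%nat) by (destruct i as [|[|[|i]]]; tauto); subst i.
  set (dl := / (8 * N)) in *.
  assert (Hdl : N * dl = / 8) by (unfold dl; field; lra).
  assert (HN3 : 3 <= N) by (unfold N; nra).
  assert (Hdl0 : 0 < dl) by (apply Rinv_0_lt_compat; lra).
  assert (HW : 0 < W) by (unfold W; nra).
  (* The axes differ by [z - / 2] with [z] an integer; this is where [E] has to be an integer. *)
  set (z := (j - (2 * e ^ 2 + 1) * j' - e ^ 2)%Z).
  assert (Hz : IZR z = IZR j - N * IZR j' - E ^ 2).
  { unfold z; rewrite !minus_IZR, mult_IZR, plus_IZR, mult_IZR, Z.pow_2_r, mult_IZR; unfold N, E; ring. }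
  assert (Hqx : fst q / (W * h) = N * (fst q / (W * (h * N)))) by (field; lra).
  apply separated_horiz with (w := W * h) (c := / 4) (Y := E * (h * N * E)); try nra.
  - unfold W; assert (E * E * (h * N) <= N * E * (h * N)); [|nra].
    apply Rmult_le_compat_r; nra.
  - rewrite Hqx.
    set (u := fst p / (W * h)) in *; set (v := fst q / (W * (h * N))) in *.
    assert (N * (IZR j' + / 2 - dl) <= N * v <= N * (IZR j' + / 2 + dl))
      by (split; apply Rmult_le_compat_l; lra).
    assert (HN2 : N * / 2 = E ^ 2 + / 2) by (unfold N; field).
    assert (Hz' : IZR z <= 0 \/ 1 <= IZR z) by (destruct (Z_le_gt_dec z 0); [left | right]; apply IZR_le; lia).
    destruct Hz' as [Hz'|Hz']; [right | left]; nra.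
Qed.

(** Cells of one colour in a row leave a gap of at least [2 * dl], the width of a wall. The unit [W]
    is chosen so that this width, [W * h * (2 * dl)], is exactly [E] times the top height
    [h * N]. *)
Lemma cell_separated_row e i b k j p b' j' q :
  (1 <= e)%Z -> let E := IZR e in let N := 2 * E ^ 2 + 1 in let W := 4 * E * N ^ 2 in
  (b, j) <> (b', j') -> cell N E W i b k j p -> cell N E W i b' k j' q -> separated E p q.
Proof.
  intros He E N W Hne Hp Hq.
  assert (HE : 1 <= E) by (apply IZR_le, He).
  assert (HEN : E <= N) by (unfold N; nra).
  pose proof (cell_height _ _ _ _ _ _ _ _ HE HEN Hp) as Hyp.
  pose proof (cell_height _ _ _ _ _ _ _ _ HE HEN Hq) as Hyq.
  pose proof (row_pos N k) as Hh; set (h := row N k) in *.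
  destruct Hp as [_ Hp], Hq as [_ Hq]; fold h in Hp, Hq.
  set (dl := / (8 * N)) in *.
  assert (HN3 : 3 <= N) by (unfold N; nra).
  assert (Hdl : N * dl = / 8) by (unfold dl; field; lra).
  assert (Hdl0 : 0 < dl) by (apply Rinv_0_lt_compat; lra).
  assert (Hdl1 : dl <= / 24) by nra.
  assert (HW : 0 < W) by (unfold W; nra).
  apply separated_horiz with (w := W * h) (c := 2 * dl) (Y := E * (h * N)); try nra.
  - right; unfold W; replace (4 * E * N ^ 2 * h * (2 * dl)) with (8 * E * N * h * (N * dl)) by ring.
    rewrite Hdl; field.
  - set (u := fst p / (W * h)) in *; set (v := fst q / (W * h)) in *.
    assert (Hz : 1 <= IZR j - IZR j' \/ 1 <= IZR j' - IZR j \/ IZR j = IZR j').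
    { destruct (Z.eq_dec j j') as [->|Hj]; [tauto|]; destruct (IZR_sep j j' Hj); tauto. }
    destruct b, b', i as [|[|[|i]]]; try tauto; try lra;
      assert (Hj : j <> j') by congruence; apply IZR_sep in Hj; lra.
Qed.

Lemma cell_separated e i b k j p b' k' j' q :
  (1 <= e)%Z -> let E := IZR e in let N := 2 * E ^ 2 + 1 in let W := 4 * E * N ^ 2 in
  (b, (k, j)) <> (b', (k', j')) -> cell N E W i b k j p -> cell N E W i b' k' j' q -> separated E p q.
Proof.
  intros He E N W Hne Hp Hq.
  destruct (Z.lt_total k k') as [Hk|[Hk|Hk]].
  - eapply cell_separated_below; eassumption.
  - subst k'; apply (cell_separated_row e i b k j p b' j' q); try assumption; congruence.
  - apply separated_sym; eapply cell_separated_below; eassumption.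
Qed.

Lemma hdist_ge_separated p q r E : inH2 p -> inH2 q -> 0 <= r -> exp r <= E ->
  separated E p q -> r <= hdist p q.
Proof.
  intros Hp Hq Hr HE [H|[H|[H1 H2]]].
  - apply hdist_ge_vert with E; assumption.
  - rewrite hdist_sym by assumption; apply hdist_ge_vert with E; assumption.
  - apply hdist_ge_horiz with E; assumption.
Qed.

Lemma cell_bounded N E W : 1 <= E -> E <= N -> 0 < W ->
  exists D, forall i b k j p q, cell N E W i b k j p -> cell N E W i b k j q -> hdist p q <= D.
Proof.
  intros HE HEN HW; exists (ln (2 * (1 + (W ^ 2 + N ^ 2) / 2))); intros i b k j p q Hp Hq.
  pose proof (cell_height _ _ _ _ _ _ _ _ HE HEN Hp) as Hyp.
  pose proof (cell_height _ _ _ _ _ _ _ _ HE HEN Hq) as Hyq.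
  pose proof (row_pos N k) as Hh; set (h := row N k) in *.
  destruct Hp as [_ Hp], Hq as [_ Hq]; fold h in Hp, Hq.
  assert (inH2 p /\ inH2 q) as [Ip Iq] by (unfold inH2; lra).
  apply hdist_le_ln; try assumption.
  apply cosh_hdist_le_box with h; try lra; try assumption; [|apply Rabs_le; nra].
  assert (Hwh : 0 < W * h) by nra.
  replace (fst p - fst q) with (W * h * (fst p / (W * h) - fst q / (W * h))) by (field; lra).
  rewrite Rabs_mult, (Rabs_pos_eq (W * h)) by lra.
  apply Rle_trans with (W * h * 1); [apply Rmult_le_compat_l; [lra|] | lra].
  set (dl := / (8 * N)) in *.
  assert (Hdl : dl <= / 8) by (apply Rinv_le_contravar; lra).
  assert (Hdl0 : 0 < dl) by (apply Rinv_0_lt_compat; lra).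
  apply Rabs_le; destruct b, i as [|[|[|i]]]; try tauto; lra.
Qed.

(** * Bounded neighbourhoods and packing *)

Lemma iter_nbhd_sub {I : Type} (valid : I -> Prop) (P : I -> pt -> Prop) (H : pt -> Prop) s m Y :
  (forall i x, valid i -> P i x -> H x) -> (forall x, Y x -> H x) ->
  forall x, iter_nbhd hdist valid P s m Y x -> H x.
Proof.
  intros HP HY; destruct m as [|m]; [exact HY|].
  intros x (i & Hi & Hx & _); apply (HP i x Hi Hx).
Qed.

Lemma iter_nbhd_bounded {I : Type} (valid : I -> Prop) (P : I -> pt -> Prop) D s m :
  (forall i x, valid i -> P i x -> inH2 x) ->
  (forall i x y, valid i -> P i x -> P i y -> hdist x y <= D) ->
  exists D', forall i x y, valid i ->
    iter_nbhd hdist valid P s m (P i) x -> iter_nbhd hdist valid P s m (P i) y -> hdist x y <= D'.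
Proof.
  intros HP HD; induction m as [|m [D' IH]]; [exists D; exact HD|].
  exists (2 * (D + s) + D'); intros i x y Hi Hx Hy.
  assert (Hsub : forall u, iter_nbhd hdist valid P s m (P i) u -> inH2 u).
  { apply iter_nbhd_sub; [exact HP | intros u; apply HP, Hi]. }
  assert (Hnear : forall u, iter_nbhd hdist valid P s (S m) (P i) u -> inH2 u /\
            exists v, iter_nbhd hdist valid P s m (P i) v /\ hdist u v <= D + s).
  { intros u (l & Hl & Hu & z & Hz & v & Hv & Hzv); split; [apply (HP l u Hl Hu)|].
    exists v; split; [exact Hv|].
    pose proof (hdist_triangle u z v (HP l u Hl Hu) (HP l z Hl Hz) (Hsub v Hv)).
    pose proof (HD l u z Hl Hu Hz); lra. }
  destruct (Hnear x Hx) as (Ix & x' & Hx' & Dx), (Hnear y Hy) as (Iy & y' & Hy' & Dy).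
  pose proof (hdist_triangle x x' y Ix (Hsub _ Hx') Iy).
  pose proof (hdist_triangle x' y' y (Hsub _ Hx') (Hsub _ Hy') Iy).
  rewrite (hdist_sym y y') in Dy by auto.
  pose proof (IH i x' y' Hi Hx' Hy'); lra.
Qed.

Definition Zrange (K : Z) : list Z := map (fun n => (Z.of_nat n - K)%Z) (seq 0 (Z.to_nat (2 * K + 1))).

Lemma in_Zrange K z : (- K <= z <= K)%Z -> In z (Zrange K).
Proof.
  intros H; apply in_map_iff; exists (Z.to_nat (z + K)); split; [lia|].
  apply in_seq; lia.
Qed.

Lemma in_Zrange_Int_part K x : Rabs x <= IZR K -> In (Int_part x) (Zrange (K + 1)).
Proof.
  intros H; destruct (base_Int_part x) as [H1 H2]; apply in_Zrange.
  assert (- IZR K <= x <= IZR K) by (unfold Rabs in H; destruct (Rcase_abs x); lra).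
  split; [apply Zlt_succ_le, lt_IZR | apply le_IZR].
  - unfold Z.succ; rewrite plus_IZR, opp_IZR, plus_IZR; lra.
  - rewrite plus_IZR; lra.
Qed.

Lemma Int_part_eq x y : Int_part x = Int_part y -> Rabs (x - y) <= 1.
Proof.
  intros E; destruct (base_Int_part x), (base_Int_part y); rewrite E in *; apply Rabs_le; lra.
Qed.

(** The ball lies in a Euclidean box with heights at least [4 * g] and sides bounded in terms of
    [g], where [g] is proportional to the height of [z]. Two points in one square of the grid of
    mesh [g] have hyperbolic cosine of distance at most [1 + / 16], less than [cosh 1]. So separated
    points occupy different squares, and the number of squares does not depend on [z]. *)
Lemma separated_packing D :
  exists n : nat, forall z l, inH2 z -> NoDup l ->
    (forall w, In w l -> inH2 w /\ hdist z w <= D) ->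
    (forall w w', In w l -> In w' l -> w <> w' -> 1 <= hdist w w') -> (length l <= n)%nat.
Proof.
  set (D0 := Rabs D + 1); set (F := exp D0).
  assert (HD0 : 1 <= D0) by (unfold D0; pose proof (Rabs_pos D); lra).
  assert (HF : 2 <= F) by (pose proof (exp_ineq1_le D0); unfold F; lra).
  (* In units of [g] the box has heights at most [4 * F ^ 2] and horizontal offsets at most
     [4 * F ^ 3]. *)
  set (K := up (4 * F ^ 3)).
  exists (length (list_prod (Zrange (K + 1)) (Zrange (K + 1)))).
  intros z l Hz Hl Hball Hsep.
  set (g := snd z / (4 * F)).
  assert (Hz0 : 0 < snd z) by exact Hz.
  assert (Hg : 0 < g) by (apply Rdiv_lt_0_compat; lra).
  assert (Hzg : snd z = 4 * F * g) by (unfold g; field; lra).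
  assert (Hbox : forall w, In w l -> 4 * g <= snd w <= F * snd z /\ Rabs (fst w - fst z) <= F ^ 2 * snd z).
  { intros w Hw; destruct (Hball w Hw) as [Iw Dw].
    assert (Dlt : hdist z w < D0) by (unfold D0; pose proof (Rle_abs D); lra).
    assert (Hns : ~ separated F z w).
    { intros Hs; apply (hdist_ge_separated z w D0) in Hs; try assumption; [lra | lra | unfold F; lra]. }
    unfold separated in Hns; rewrite (Rabs_minus_sym (fst z)) in Hns.
    destruct (Rle_or_lt (F * snd z) (snd w)) as [|H1]; [tauto|].
    destruct (Rle_or_lt (F * snd w) (snd z)) as [|H2]; [tauto|].
    split; [split; [|lra]|].
    - rewrite Hzg in H2; apply Rmult_le_reg_l with F; lra.
    - destruct (Rle_or_lt (Rabs (fst w - fst z)) (F ^ 2 * snd z)) as [|H3]; [assumption|].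
      exfalso; apply Hns; right; right; split; nra. }
  set (code := fun w : pt => (Int_part ((fst w - fst z) / g), Int_part (snd w / g))).
  rewrite <- (length_map code l); apply NoDup_incl_length.
  - apply NoDup_map_NoDup_ForallPairs; [|exact Hl].
    intros w w' Hw Hw' E; unfold code in E; injection E as E1 E2.
    destruct (excluded_middle_informative (w = w')) as [|Hne]; [assumption|].
    exfalso; specialize (Hsep w w' Hw Hw' Hne).
    destruct (Hball w Hw) as [Iw _], (Hball w' Hw') as [Iw' _].
    destruct (Hbox w Hw) as [[B1 _] _], (Hbox w' Hw') as [[B2 _] _].
    apply Int_part_eq in E1; apply Int_part_eq in E2.
    assert (Scale : forall a b, Rabs (a / g - b / g) <= 1 -> Rabs (a - b) <= / 4 * (4 * g)).
    { intros a b Hab; replace (a - b) with (g * (a / g - b / g)) by (field; lra).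
      rewrite Rabs_mult, (Rabs_pos_eq g) by lra; nra. }
    apply Scale in E1; apply Scale in E2.
    replace (fst w - fst z - (fst w' - fst z)) with (fst w - fst w') in E1 by ring.
    pose proof (cosh_hdist_le_box w w' (4 * g) (/ 4) (/ 4) Iw Iw' ltac:(lra) B1 B2 E1 E2) as Hc.
    rewrite <- cosh_hdistE in Hc by assumption.
    pose proof (cosh_le_mono 1 (hdist w w') ltac:(lra) Hsep) as Hc1.
    unfold cosh at 1 in Hc1; rewrite exp_Ropp in Hc1.
    pose proof (exp_ineq1_le 1); pose proof exp_le_3.
    assert (/ 3 <= / exp 1) by (apply Rinv_le_contravar; lra); lra.
  - intros c Hc; apply in_map_iff in Hc; destruct Hc as (w & <- & Hw).
    destruct (Hbox w Hw) as [[B1 B2] B3].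
    destruct (archimed (4 * F ^ 3)) as [HK _]; fold K in HK.
    apply in_prod; apply in_Zrange_Int_part; left; eapply Rle_lt_trans; [|exact HK | |exact HK];
      unfold Rdiv; rewrite Rabs_mult, (Rabs_pos_eq (/ g)) by (left; apply Rinv_0_lt_compat; exact Hg);
      apply Rmult_le_reg_r with g; try exact Hg; rewrite Rmult_assoc, Rinv_l, Rmult_1_r by lra.
    + rewrite Hzg in B3; lra.
    + rewrite Hzg in B2; rewrite Rabs_pos_eq by lra.
      apply (Rle_trans _ _ _ B2).
      assert (0 <= F * F * g) by nra; simpl; nra.
Qed.

Lemma poly_asdim_prop_three_colours d X : max_1_separated X -> poly_asdim_prop hdist X d 2.
Proof.
  intros (HX & Hsep & _) r Hr.
  set (e := up (exp r)); destruct (archimed (exp r)) as [He _]; fold e in He.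
  assert (Hexp : 1 <= exp r) by (rewrite <- exp_0; apply exp_le_mono; lra).
  assert (He1 : (1 <= e)%Z) by (apply le_IZR; lra).
  set (E := IZR e) in *; set (N := 2 * E ^ 2 + 1); set (W := 4 * E * N ^ 2).
  assert (HE : 1 <= E) by lra.
  assert (HEN : E <= N) by (unfold N; nra).
  assert (HN : 1 < N) by (unfold N; nra).
  assert (HW : 0 < W) by (unfold W; nra).
  exists (bool * (Z * Z))%type,
    (fun i c p => X p /\ cell N E W i (fst c) (fst (snd c)) (snd (snd c)) p).
  split; [|split].
  - intros x; split; [|intros (i & j & _ & Hx & _); exact Hx].
    intros Hx; destruct (cell_cover N E W x HN (HX x Hx)) as (i & b & k & j & Hi & Hc).
    exists i, (b, (k, j)); split; [exact Hi | split; assumption].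
  - intros i [b [k j]] [b' [k' j']] _ Hne x y [Hx Cx] [Hy Cy]; cbn [fst snd] in *.
    pose proof (cell_separated e _ _ _ _ _ _ _ _ _ He1 Hne Cx Cy) as Hs; fold E in Hs.
    split.
    + intros ->; pose proof (HX y Hy) as Iy; unfold inH2 in Iy.
      assert (Hs1 : hdist y y = 0) by (apply hdist_refl, HX, Hy).
      destruct (Rle_lt_or_eq_dec 0 r Hr) as [Hr0|Hr0].
      * apply (hdist_ge_separated y y r) in Hs; try (apply HX; assumption); try assumption; lra.
      (* For [r = 0] the distance bound says nothing, but [E > 1] already prevents a point from
         being [separated] from itself. *)
      * subst r; rewrite exp_0 in He; unfold separated in Hs.
        replace (fst y - fst y) with 0 in Hs by ring; rewrite Rabs_R0 in Hs; nra.
    + apply hdist_ge_separated with E; try (apply HX; assumption); try assumption; lra.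
  - intros m s _ _.
    set (P := fun c : nat * (bool * (Z * Z)) => fun p : pt => X p /\
      cell N E W (fst c) (fst (snd c)) (fst (snd (snd c))) (snd (snd (snd c))) p).
    destruct (cell_bounded N E W HE HEN HW) as [D HD].
    destruct (iter_nbhd_bounded (fun c => (fst c <= 2)%nat) P D s m) as [D' HD'].
    { intros i x _ [Hx _]; apply HX, Hx. }
    { intros i x y _ [_ Hx] [_ Hy]; eapply HD; eassumption. }
    destruct (separated_packing D') as [n Hn].
    (* The neighbourhoods have at most [n] points, so the constant term alone bounds the growth. *)
    exists (INR n); intros i c Hi z rho Hz Hrho l Hl Hin.
    assert (Hsub : forall x, iter_nbhd hdist (fun c => (fst c <= 2)%nat) P s m (P (i, c)) x -> X x).
    { apply iter_nbhd_sub; [intros ? x _ [Hx _]; exact Hx | intros x [Hx _]; exact Hx]. }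
    assert (Hlen : INR (length l) <= INR n).
    { apply le_INR, (Hn z l); [apply HX, Hsub, Hz | exact Hl | |].
      - intros w Hw; destruct (Hin w Hw) as [Hw' _]; split; [apply HX, Hsub, Hw'|].
        apply (HD' (i, c)); [exact Hi | exact Hz | exact Hw'].
      - intros w w' Hw Hw'; apply Hsep; apply Hsub; apply Hin; assumption. }
    assert (0 <= INR n * rho ^ d) by (apply Rmult_le_pos; [apply pos_INR | apply pow_le, Hrho]).
    lra.
Qed.

Theorem theoremF : forall (d : nat) (X : pt -> Prop),
  max_1_separated X -> poly_asdim_eq hdist X d 2.
Proof.
  intros d X HX; split; [apply poly_asdim_prop_three_colours, HX|].
  intros k Hk; apply not_poly_asdim_two_colours; [exact HX | lia].
Qed.
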